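(* Let $W$ be the $n\times n$ random interaction matrix generated by random mixed interactions with connection probability $P$ and strength variable $Z$ of variance $\sigma^2$, and let $-L=W-I$. Put $\alpha=(n-1)P\,\mathbb{E}(|Z|)$, $$\tau_{c,u}=\frac{\alpha}{\sqrt{\alpha^{2}+nP\sigma^2}}\arctan\!\left(\frac{\alpha}{\sqrt{nP\sigma^2}}\right),\qquad \tau_{c,l}=\frac{\alpha\pi}{2\alpha+2\sqrt{nP\sigma^2}},$$ and $\tau_c^*=\tau_c^*(n)=\min\{\tau_{c,u},\tau_{c,l}\}$. Then, for large $n$, if $\tau_c\in[0,\tau_c^* )$, the continuous-time delayed system $\dot X(t)=-LX(t-\tau_c)$ converges. That is, for every $\tau_c\ge0$, the probability that the implication ''$\tau_c<\tau_c^*(n)$ implies that $\lim_{t\to\infty}X(t)$ exists for every initial condition'' holds tends to $1$ as $n\to\infty$.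
   Context: Random mixed interactions: fix a real random variable $Z$ with $\mathbb{E}(Z)=0$ and variance $\sigma^2\in(0,\infty)$, and $P\in(0,1]$, not depending on $n$. The matrix $S=[s_{ij}]\in\mathbb{R}^{n\times n}$ has $s_{ii}=0$, and for each ordered pair $i\ne j$ independently, with probability $P$ the entry $s_{ij}$ is an independent copy of $Z$, otherwise $s_{ij}=0$. Then $w_{ij}=s_{ij}/|S|_i$ for $i\neq j$ and $w_{ii}=0$, where $|S|_i=\sum_j|s_{ij}|$ (all positive with probability tending to $1$). The continuous-time system is $\dot x_i(t)=\sum_{j}w_{ij}\bigl(x_j(t-\tau_c)-\mathrm{sgn}(w_{ij})x_i(t-\tau_c)\bigr)$, $i=1,\dots,n$, i.e. $\dot X(t)=-LX(t-\tau_c)$ where $-L$ has off-diagonal entries $w_{ij}$ and diagonal entries $-\sum_{k\ne i}|w_{ik}|=-1$. Initial conditions are continuous functions on $[-\tau_c,0]$. *)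

(* Defs.v *)
(* MathComp-Analysis, over an abstract [R : realType]. *)
From HB Require Import structures.
From mathcomp Require Import all_boot all_order all_algebra.
From mathcomp Require Import all_classical all_reals all_analysis.

Set Implicit Arguments.
Unset Strict Implicit.
Unset Printing Implicit Defensive.

Import Order.TTheory GRing.Theory Num.Theory.
Import numFieldNormedType.Exports.

Local Open Scope classical_set_scope.
Local Open Scope ring_scope.

(* The probability of an event that is not assumed to be measurable; by
   [inner_probE] it is [P E] as soon as [E] is measurable.  It is used because
   the event "every solution converges" quantifies over a function space. *)
Definition inner_prob (d : measure_display) (T : measurableType d)
    (R : realType) (P : probability T R) (E : set T) : \bar R :=
  ereal_sup [set P A | A in [set A | measurable A /\ A `<=` E]].

Lemma inner_probE (d : measure_display) (T : measurableType d)
    (R : realType) (P : probability T R) (E : set T) :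
  measurable E -> inner_prob P E = P E.
Proof.
move=> mE; apply/eqP; rewrite eq_le; apply/andP; split.
  by apply: ge_ereal_sup => _ [A [mA AE] <-]; apply: le_measure; rewrite ?inE.
by apply: ereal_sup_ubound; exists E => //; split.
Qed.

(* [sel i j] tells whether the ordered pair (i, j) is connected and [str i j]
   is the strength used in that case; the diagonal entries of both families are
   irrelevant and unconstrained.  The second item says that [str i j] has the
   law of [Z].  The last item is the mutual independence of the whole
   off-diagonal family: subfamilies are obtained by taking some of the
   [A i j], [C i j] to be full sets. *)
Definition random_mixed_interactions
    (R : realType) (dZ : measure_display) (TZ : measurableType dZ)
    (PZ : probability TZ R) (Z : {RV PZ >-> R}) (p : R)
    (d : measure_display) (T : measurableType d) (P : probability T R) (n : nat)
    (sel : 'I_n -> 'I_n -> {RV P >-> bool})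
    (str : 'I_n -> 'I_n -> {RV P >-> R}) : Prop :=
  [/\ forall i j, i != j -> P (sel i j @^-1` [set true]) = p%:E,
      forall i j, i != j -> forall C : set R, measurable C ->
        distribution P (str i j) C = distribution PZ Z C &
      forall (A : 'I_n -> 'I_n -> set bool) (C : 'I_n -> 'I_n -> set R),
        (forall i j, measurable (A i j)) -> (forall i j, measurable (C i j)) ->
        P (\bigcap_(k in [set k : 'I_n * 'I_n | k.1 != k.2])
             (sel k.1 k.2 @^-1` A k.1 k.2 `&` str k.1 k.2 @^-1` C k.1 k.2))
        = (\prod_(k : 'I_n * 'I_n | k.1 != k.2)
             (P (sel k.1 k.2 @^-1` A k.1 k.2) *
              P (str k.1 k.2 @^-1` C k.1 k.2)))%E].

Definition strength_matrix (R : realType) (n : nat)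
    (sel : 'I_n -> 'I_n -> bool) (str : 'I_n -> 'I_n -> R) : 'M[R]_n :=
  \matrix_(i, j) if (i != j) && sel i j then str i j else 0.

(* A row of [S] that vanishes gives a zero row, since [0^-1 = 0]. *)
Definition interaction_matrix (R : realType) (n : nat) (S : 'M[R]_n) : 'M[R]_n :=
  \matrix_(i, j) if i == j then 0 else S i j / \sum_k `|S i k|.

Definition random_interaction_matrix (R : realType)
    (d : measure_display) (T : measurableType d) (P : probability T R) (n : nat)
    (sel : 'I_n -> 'I_n -> {RV P >-> bool})
    (str : 'I_n -> 'I_n -> {RV P >-> R}) (w : T) : 'M[R]_n :=
  interaction_matrix
    (strength_matrix (fun i j => sel i j w) (fun i j => str i j w)).

(* [X] solves X'(t) = - L X(t - tau) for t > 0 with history [phi].  Only the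
   values of [phi] on [-tau, 0] and of [X] on [-tau, +oo[ matter.  Derivatives
   are taken entrywise as 'cV[R]_n is not a normed space for an arbitrary [n] in
   the library. *)
Definition delayed_solution (R : realType) (n : nat) (L : 'M[R]_n) (tau : R)
    (phi X : R -> 'cV[R]_n) : Prop :=
  [/\ forall t, - tau <= t <= 0 -> X t = phi t,
      {within `[- tau, +oo[, continuous X} &
      forall (t : R) (i : 'I_n), 0 < t ->
        is_derive t (1 : R) (fun s => X s i 0) ((- L *m X (t - tau)) i 0)].

Definition delayed_system_converges (R : realType) (n : nat) (L : 'M[R]_n)
    (tau : R) : Prop :=
  forall phi X : R -> 'cV[R]_n,
    {within `[- tau, 0], continuous phi} -> delayed_solution L tau phi X ->
    cvg (X t @[t --> +oo]).

Definition alpha (R : realType) (p absZ : R) (n : nat) : R :=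
  (n%:R - 1) * p * absZ.

Definition tau_u (R : realType) (p sigma absZ : R) (n : nat) : R :=
  let a := alpha p absZ n in
  let v := n%:R * p * sigma ^+ 2 in
  a / Num.sqrt (a ^+ 2 + v) * atan (a / Num.sqrt v).

Definition tau_l (R : realType) (p sigma absZ : R) (n : nat) : R :=
  let a := alpha p absZ n in
  let v := n%:R * p * sigma ^+ 2 in
  a * pi / (2 * a + 2 * Num.sqrt v).

Definition tau_star (R : realType) (p sigma absZ : R) (n : nat) : R :=
  Num.min (tau_u p sigma absZ n) (tau_l p sigma absZ n).

(* Main.v *)
(** Since [tau_l <= pi / 2], only [tau < pi / 2] matters; then it suffices that
    the operator norm of [W] is below a constant depending on [tau] alone.

    Delay equation.  For [x'(t) = - x(t - tau)] and [g = pi / 4 - tau / 2], the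
    quadratic form
      [cos g x(t)^2 - 2 x(t) int_0^tau sin(a + g) x(t - a) da
        + iint_[0,tau]^2 cos(|a - b| + g) x(t - a) x(t - b) da db]
    has derivative [- 2 sin g x(t)^2].  It is nonnegative: completing the square
    in [x(t)] leaves the kernel [cos(max + 2 g) cos(min) / cos g], which is a sum
    of squares exactly because [tau <= pi / 2].  Adding a small multiple of a
    weighted integral of [|X|^2] over the last [tau] units of time absorbs a
    small coupling [W], so [|X|^2] is integrable and [X] tends to [0].

    Random matrix.  Only a second moment is available, so each strength is cut at
    a large constant [B].  The tails are small in Frobenius norm (Markov), the
    means of the cut entries are small because [Z] is centered, and the centered
    cut entries [x] satisfy [E |x^T x|_F^2 = O(n^3)] by independence, so their
    operator norm is [o(n)].  The row sums are at least [c n] by a Chernoff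
    bound, whence the operator norm of [W] tends to [0] in probability. *)

Require Import Defs.
From HB Require Import structures.
From mathcomp Require Import all_boot all_order all_algebra.
From mathcomp Require Import all_classical all_reals all_analysis.
From mathcomp Require Import measurable_realfun.
From mathcomp Require Import ring lra.

Set Implicit Arguments.
Unset Strict Implicit.
Unset Printing Implicit Defensive.

Import Order.TTheory GRing.Theory Num.Theory.
Import numFieldNormedType.Exports.

Local Open Scope classical_set_scope.
Local Open Scope ring_scope.

(** * Stability of the delay equation *)

Lemma le_of_is_derive (R : realType) (f g : R -> R) (a b : R) : a <= b ->
  (forall t, a < t < b -> is_derive t 1 f (g t) /\ 0 <= g t) ->
  (forall t, a <= t <= b -> {for t, continuous f}) -> f a <= f b.
Proof.
move=> ab df cf.
apply: (@ger0_derive1_ndecr R f a b) => //.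
- by move=> x /[!in_itv]/= /df[].
- by move=> x /[!in_itv]/= /df[dfx g0]; rewrite derive1E derive_val.
- by apply: continuous_in_subspaceT => x; rewrite inE/= in_itv/=; exact: cf.
Qed.

Lemma ge_of_is_derive (R : realType) (f g : R -> R) (a b : R) : a <= b ->
  (forall t, a <= t <= b -> is_derive t 1 f (g t)) ->
  (forall t, a <= t <= b -> g t <= 0) -> f b <= f a.
Proof.
move=> ab df g0; rewrite -lerN2.
apply: (@le_of_is_derive _ (fun t => - f t) (fun t => - g t)) => // t tab.
  have tab' : a <= t <= b by case/andP: tab => /ltW -> /ltW ->.
  have ? := df _ tab'; split; last by rewrite oppr_ge0 g0.
  exact: is_deriveN.
apply/continuousN/differentiable_continuous/derivable1_diffP.
by have [] := df _ tab.
Qed.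

Lemma is_derive_delay (R : realType) (f : R -> R) (df t tau : R) :
  is_derive (t - tau) 1 f df -> is_derive t 1 (fun s => f (s - tau)) df.
Proof.
move=> dft.
have shf : is_derive t (1 : R) (fun s : R => s - tau) 1.
  by apply: is_derive_eq; rewrite subr0.
by apply: is_derive_eq; rewrite mulr1.
Qed.

(** * Lyapunov functional of the scalar equation [x'(t) = - x(t - tau) + f] *)

Section scalar_delay_lyapunov.
Variables (R : realType) (tau g : R) (x C S H : R -> R).
Hypothesis tau_ge0 : 0 <= tau.
Hypothesis tau_lt : tau < pi / 2.
Hypothesis g_def : g = pi / 4 - tau / 2.
Hypothesis dC : forall t : R, - tau <= t -> is_derive t 1 C (cos t * x t).
Hypothesis dS : forall t : R, - tau <= t -> is_derive t 1 S (sin t * x t).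
Hypothesis dH : forall t : R, - tau <= t ->
  is_derive t 1 H (cos t * x t * S t - sin t * x t * C t).

(* [int_s^t sin(t - u + g) x(u) du].  Writing it and [delay_energy] through the
   primitives [C], [S], [H] avoids differentiating under an integral sign. *)
Definition delay_moment (t s : R) : R :=
  sin (t + g) * (C t - C s) - cos (t + g) * (S t - S s).

(* [int_(s < v < u < t) cos(u - v + g) x(u) x(v) du dv]. *)
Definition delay_energy (t s : R) : R :=
  cos g * (C t ^+ 2 + S t ^+ 2) / 2 + sin g * H t
  - (cos g * (C s ^+ 2 + S s ^+ 2) / 2 + sin g * H s)
  - C s * (cos g * (C t - C s) - sin g * (S t - S s))
  - S s * (cos g * (S t - S s) + sin g * (C t - C s)).

(** This is [cos g] times the quadratic form of the introduction, which makes completing the square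
    in [cos g * x t] free of division. The square [[0, tau]^2] counts the triangle of [delay_energy]
    twice. *)
Definition delay_lyapunov (t : R) : R :=
  (cos g * x t) ^+ 2 - 2 * (cos g * x t * delay_moment t (t - tau))
  + 2 * (cos g * delay_energy t (t - tau)).

Let cos_tau_gt0 (b : R) : 0 <= b <= tau -> 0 < cos b.
Proof.
move=> /andP[b0 bt]; apply: cos_gt0_pihalf; rewrite (le_lt_trans bt)// andbT.
by rewrite (lt_le_trans _ b0)// oppr_lt0 divr_gt0// pi_gt0.
Qed.

Let tauE : tau = pi / 2 - (g + g).
Proof. by rewrite g_def; field. Qed.

Let cos_tauE : cos tau = 2 * sin g * cos g.
Proof. by rewrite tauE cosB cos_pihalf sin_pihalf sinD; ring. Qed.

Let sin_tauE : sin tau = cos g ^+ 2 - sin g ^+ 2.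
Proof. by rewrite tauE sinB cos_pihalf sin_pihalf cosD; ring. Qed.

(** This is the remainder after completing the square. The function [D] below vanishes at [s = t],
    is nonincreasing in [s] because its derivative is minus a square times a positive factor, and
    equals the wanted difference at [s = t - tau]. *)
Lemma delay_energy_ge (t : R) : 0 <= t ->
  delay_moment t (t - tau) ^+ 2 <= 2 * (cos g * delay_energy t (t - tau)).
Proof.
move=> t0.
(* This is [int_s^t cos(t - u) x(u) du], the moment of [x] against the factor [cos(min)] of the
   reduced kernel. *)
pose F s := cos t * (C t - C s) + sin t * (S t - S s).
(* The coefficient of [F s ^+ 2] is [cos (a + 2 g) / cos a] with [a = t - s]:
   the ratio [v / u] of the reduced kernel [u(min) v(max)].  It is decreasing in
   [a] and vanishes at [a = tau]. *)
pose D s := 2 * (cos g * delay_energy t s) - delay_moment t s ^+ 2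
  - (cos g ^+ 2 - sin g ^+ 2 - 2 * sin g * cos g * tan (t - s)) * F s ^+ 2.
pose D' s := - (2 * sin g * cos g * (cos (t - s)) ^- 2 * F s ^+ 2).
have : D t <= D (t - tau).
  apply: (@ge_of_is_derive _ D D' (t - tau) t); first by rewrite gerBl.
  - move=> s /andP[ts st].
    have s_ge : - tau <= s by rewrite (le_trans _ ts)// lerBDr addrC subrr.
    have ct : cos (t - s) != 0.
      by apply: lt0r_neq0; apply: cos_tau_gt0; rewrite subr_ge0 st/= lerBlDr -lerBlDl.
    have ? := dC s_ge; have ? := dS s_ge; have ? := dH s_ge.
    have shf : is_derive s (1 : R) (fun u : R => t - u) (-1).
      by apply: is_derive_eq; ring.
    have dtan := is_derive_tan ct.
    have ? : is_derive s (1 : R) (fun u : R => tan (t - u)) (- (cos (t - s)) ^- 2).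
      by apply: is_derive_eq; rewrite mulrN1.
    rewrite /D /delay_energy /delay_moment /F.
    apply: is_derive_eq.
    rewrite /D' /F /GRing.scale/= /tan.
    (* Writing [s] as [t - (t - s)] leaves only the cosines and sines of [t], [t - s] and [g]; the
       claim is then a rational identity modulo the three relations [cos^2 + sin^2 = 1]. *)
    have := cos2Dsin2 g; have := cos2Dsin2 t; have := cos2Dsin2 (t - s).
    have -> : cos s = cos t * cos (t - s) + sin t * sin (t - s).
      by rewrite -cosB subKr.
    have -> : sin s = sin t * cos (t - s) - cos t * sin (t - s).
      by rewrite -sinB subKr.
    rewrite (cosD t g) (sinD t g).
    move: (cos t) (sin t) (cos (t - s)) (sin (t - s)) (cos g) (sin g) ct.
    move=> c1 s1 cb sb cg sg cb0.
    move=> /(canRL (addKr _)) eb /(canRL (addKr _)) et /(canRL (addKr _)) eg.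
    by field: eb et eg.
  - move=> s /andP[ts st]; rewrite /D' oppr_le0 mulr_ge0 ?sqr_ge0// mulr_ge0//.
      by rewrite -cos_tauE ltW// cos_tau_gt0// tau_ge0/=.
    by rewrite invr_ge0 sqr_ge0.
have -> : D t = 0 by rewrite /D /delay_energy /delay_moment /F; ring.
suff -> : D (t - tau) = 2 * (cos g * delay_energy t (t - tau)) - delay_moment t (t - tau) ^+ 2.
  by rewrite subr_ge0.
(* At this endpoint the coefficient of [F s ^+ 2] is [sin tau - cos tau * tan tau], which is [0]
   because [cos tau] is nonzero. *)
rewrite /D (_ : t - (t - tau) = tau); last by ring.
rewrite -cos_tauE -sin_tauE /tan (mulrC (cos tau)) mulfVK ?subrr ?mul0r ?subr0//.
by apply: lt0r_neq0; apply: cos_tau_gt0; rewrite tau_ge0/=.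
Qed.

Lemma delay_lyapunov_ge0 (t : R) : 0 <= t -> 0 <= delay_lyapunov t.
Proof.
move=> t0; apply: le_trans (sqr_ge0 (cos g * x t - delay_moment t (t - tau))) _.
rewrite /delay_lyapunov sqrrB -mulr_natl lerD2l; exact: delay_energy_ge.
Qed.

(** The choice of [g] gives [tau + g = pi / 2 - g], hence [sin(tau + g) = cos g] and
    [cos(tau - a + g) = sin(a + g)]. So all terms in [x (t - tau)] cancel, and besides the forcing
    only [- 2 sin g cos g x(t)^2] survives. *)
Lemma is_derive_delay_lyapunov (t f : R) : 0 <= t ->
  is_derive t 1 x (- x (t - tau) + f) ->
  is_derive t 1 delay_lyapunov
    (- (cos tau * x t ^+ 2) +
     2 * (cos g * ((cos g * x t - delay_moment t (t - tau)) * f))).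
Proof.
move=> t0 dx.
have t_ge : - tau <= t by rewrite (le_trans _ t0)// oppr_le0.
have td_ge : - tau <= t - tau by rewrite lerBrDr addNr.
have ? := dC t_ge; have ? := dS t_ge; have ? := dH t_ge.
have ? := is_derive_delay (dC td_ge).
have ? := is_derive_delay (dS td_ge).
have ? := is_derive_delay (dH td_ge).
have sh : is_derive t (1 : R) (fun u : R => u + g) 1.
  by apply: is_derive_eq; ring.
rewrite /delay_lyapunov /delay_energy /delay_moment.
apply: is_derive_eq.
rewrite /GRing.scale/= cos_tauE.
have := cos2Dsin2 g; have := cos2Dsin2 t.
rewrite (cosB t tau) (sinB t tau) cos_tauE sin_tauE (cosD t g) (sinD t g).
move: (cos t) (sin t) (cos g) (sin g) => c1 s1 cg sg.
move=> /(canRL (addKr _)) et /(canRL (addKr _)) eg.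
by field: et eg.
Qed.

(** Cauchy-Schwarz through primitives. With [m] half the moment, the integral of
    [x^2 + m^2 - 2 m sin(t + g - u) x] over the window is nonnegative, so the increment of [J] is at
    least [(4 - tau) m^2]; the factor 2 then comes from [tau <= 2]. *)
Lemma delay_moment_sqr_le (J : R -> R) (t : R) : 0 <= t ->
  (forall s : R, - tau <= s -> is_derive s 1 J (x s ^+ 2)) ->
  delay_moment t (t - tau) ^+ 2 <= 2 * (J t - J (t - tau)).
Proof.
move=> t0 dJ.
pose m := delay_moment t (t - tau) / 2.
pose G s := - J s - m ^+ 2 * s - 2 * (m * delay_moment t s).
pose G' s := - (x s ^+ 2 + m ^+ 2 - 2 * (m * (sin (t + g - s) * x s))).
have : G t <= G (t - tau).
  apply: (@ge_of_is_derive _ G G' (t - tau) t); first by rewrite gerBl.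
  - move=> s /andP[ts st].
    have s_ge : - tau <= s by rewrite (le_trans _ ts)// lerBDr addrC subrr.
    have ? := dC s_ge; have ? := dS s_ge; have ? := dJ _ s_ge.
    rewrite /G /delay_moment; apply: is_derive_eq.
    by rewrite /G' /GRing.scale/= sinB; ring.
  - move=> s _; rewrite /G' oppr_le0.
    have := sqr_ge0 (x s - m * sin (t + g - s)).
    have := mulr_ge0 (sqr_ge0 m) (sqr_ge0 (cos (t + g - s))).
    rewrite cos2sin2; move: (sin _) (x s) => a b; nra.
rewrite /G (_ : delay_moment t t = 0); last by rewrite /delay_moment; ring.
have tau2 : 0 <= 2 - tau by rewrite subr_ge0 ltW// (lt_trans tau_lt)// pihalf_lt2.
have := mulr_ge0 (sqr_ge0 m) tau2.
have -> : delay_moment t (t - tau) = 2 * m by rewrite /m; field.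
move: (J t) (J (t - tau)) => a b; nra.
Qed.

End scalar_delay_lyapunov.

(** * Decay of solutions of the weakly coupled system *)

Lemma is_derive_bigsum (R : realType) (n : nat) (h : 'I_n -> R -> R)
    (dh : 'I_n -> R) (t : R) :
  (forall i, is_derive t (1 : R) (h i) (dh i)) ->
  is_derive t (1 : R) (fun s => \sum_i h i s) (\sum_i dh i).
Proof. by move=> ?; rewrite -fct_sumE; exact: is_derive_sum. Qed.

(** A solution is controlled only from [- tau] on; freezing it before that time yields a function
    continuous on the whole line. *)
Lemma continuous_clamp (R : realType) (V : topologicalType) (a : R) (f : R -> V) :
  {within `[a, +oo[, continuous f} -> continuous (fun t => f (Order.max t a)).
Proof.
move=> /subspace_continuousP cf t.
have at_ge : a <= Order.max t a by rewrite le_max lexx orbT.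
apply: cvg_trans (cf (Order.max t a) _); last by rewrite /= in_itv/= at_ge.
have cm : {for t, continuous (fun s : R => Order.max s a : R^o)}.
  by apply: (@continuous_max _ _ id (cst a)); [exact: cvg_id|exact: cvg_cst].
move=> A nA; apply: (@filterS _ (nbhs t) _ _ _ _ (cm _ nA)) => s; apply.
by rewrite /= in_itv/= le_max lexx orbT.
Qed.

Lemma continuous_antiderivative (R : realType) (f : R -> R) (a : R) :
  (forall t, a <= t -> {for t, continuous f}) ->
  exists F : R -> R, forall t, a <= t -> is_derive t 1 F (f t).
Proof.
move=> caf; pose h t := f (Order.max t a).
have ch : continuous h.
  apply: continuous_clamp; apply: continuous_in_subspaceT => t.
  by rewrite inE/= in_itv/= andbT; exact: caf.
(* Starting the integral at [a - 1] makes [a] an interior point, so the derivative there is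
   two-sided. *)
exists (fun t => \int[lebesgue_measure]_(s in `[a - 1, t]) h s)%R => t at0.
have [] := @continuous_FTC1_closed R h (a - 1) t (t + 1).
- by rewrite ltrDl.
- apply: continuous_compact_integrable; first exact: segment_compact.
  exact: continuous_subspaceT.
- by rewrite ltrBlDr (le_lt_trans at0)// ltrDl.
- exact: ch.
- rewrite derive1E {3}/h; move/max_idPl : (at0) => -> d1 d2; exact: DeriveDef.
Qed.

(* Integrate [y t <= y s + (increments of J)] over [s] in the unit interval
   before [t]: the integral of [y] there is itself an increment of [J]. *)
Lemma bounded_primitive_vanishes (R : realType) (J y : R -> R) (tau B : R) :
  0 <= tau ->
  (forall t, - tau <= t -> is_derive t (1 : R) J (y t)) ->
  (forall t, 0 <= y t) ->
  (forall t, 1 <= t -> J t <= B) ->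
  (forall s t, 1 <= s -> s <= t ->
    y t <= y s + (J t - J s) + 4 * (J (t - tau) - J (s - tau))) ->
  forall e, 0 < e -> exists N, forall t, N <= t -> y t <= e.
Proof.
move=> tau0 dJ y0 JB hy e e0.
have Jmono (s t : R) : - tau <= s -> s <= t -> J s <= J t.
  move=> as_ st.
  rewrite -lerN2; apply: (@ge_of_is_derive _ (fun u => - J u) (fun u => - y u)) => //.
    move=> u /andP[su ut]; have ? := dJ u (le_trans as_ su).
    exact: is_deriveN.
  by move=> u _; rewrite oppr_le0.
pose E := [set J t | t in [set t | 1 <= t]].
have supE : has_sup E.
  split; first by exists (J 1), 1 => //=.
  by exists B => _ [t /= t1 <-]; exact: JB.
(* Six increments of [J] are spent in all: one and four in [hy], and one for the integral of [y]
   over a unit interval. *)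
have e6 : 0 < e / 6 by rewrite divr_gt0.
have [_ [N /= N1 <-] HN] := sup_adherent e6 supE.
have Jle t : 1 <= t -> J t <= sup E.
  by move=> t1; apply: (ub_le_sup supE.2); exists t.
(* The margin keeps [s - tau] beyond [N] for all [s] in [[t - 1, t]]. *)
exists (N + 1 + tau) => t Nt.
have osc (s u : R) : N <= s -> s <= u -> J u - J s <= e / 6.
  move=> Ns su.
  have h1 : J u <= sup E by apply: Jle; lra.
  have h2 : J N <= J s by apply: Jmono => //; lra.
  by lra.
pose G s := (y t - 5 * (e / 6)) * s - J s.
have : G t <= G (t - 1).
  apply: (@ge_of_is_derive _ G (fun s => y t - 5 * (e / 6) - y s)); first lra.
    move=> s /andP[ts st]; have ? : is_derive s (1 : R) J (y s) by apply: dJ; lra.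
    by rewrite /G; apply: is_derive_eq; rewrite /GRing.scale/=; ring.
  move=> s /andP[ts st].
  have h1 : y t <= y s + (J t - J s) + 4 * (J (t - tau) - J (s - tau)).
    by apply: hy => //; lra.
  have h2 : J t - J s <= e / 6 by apply: osc; lra.
  have h3 : J (t - tau) - J (s - tau) <= e / 6 by apply: osc; lra.
  by lra.
have h2 : J t - J (t - 1) <= e / 6 by apply: osc; lra.
by rewrite /G; lra.
Qed.

Lemma cvg_col_sqr (R : realType) (n : nat) (X : R -> 'cV[R]_n) :
  (forall e : R, 0 < e -> exists N : R, forall t : R, N <= t -> \sum_i X t i 0 ^+ 2 <= e) ->
  X t @[t --> +oo] --> (0 : 'cV[R]_n).
Proof.
move=> h; apply/cvg_ballP => e e0.
have [N hN] := h ((e / 2) ^+ 2) (exprn_gt0 _ (divr_gt0 e0 (ltr0Sn _ _))).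
exists N; split; first exact: num_real.
move=> t /ltW /hN le_e; split => // i j; rewrite ord1 !mxE /ball/= sub0r normrN.
apply: (@le_lt_trans _ _ (e / 2)); last by lra.
have e20 : 0 <= e / 2 by lra.
rewrite -ler_sqr ?nnegrE// real_normK ?num_real// (le_trans _ le_e)//.
by rewrite (bigD1 i)//= lerDl sumr_ge0// => k _; rewrite sqr_ge0.
Qed.

(** The scalar functionals are summed over the coordinates, and the coupling enters as a forcing
    term. The threshold [e] is chosen before [n], which is what allows it to be used along a
    sequence of growing matrices. *)
Lemma small_coupling_converges (R : realType) (tau : R) :
  0 <= tau -> tau < pi / 2 ->
  exists2 e : R, 0 < e & forall (n : nat) (W : 'M[R]_n),
    (forall u : 'I_n -> R, \sum_i (\sum_j W i j * u j) ^+ 2 <=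
       e ^+ 2 * \sum_j u j ^+ 2) ->
    delayed_system_converges (1%:M - W) tau.
Proof.
move=> tau0 taupi.
have ctau : 0 < cos tau.
  apply: cos_gt0_pihalf; rewrite taupi andbT (lt_le_trans _ tau0)//.
  by rewrite oppr_lt0 divr_gt0// pi_gt0.
have tau2 : tau < 2 by rewrite (lt_trans taupi)// pihalf_lt2.
have tau2' : 0 <= 2 - tau by rewrite subr_ge0 ltW.
(* The losses proportional to [y t] are [2 e] from the forcing estimate and [4 e (tau + 1) <= 12 e]
   from the window term. Their total [14 e] is half of the dissipation [cos tau]. *)
pose e := cos tau / 28.
have e0 : 0 < e by rewrite divr_gt0.
have e1 : e <= 1 by rewrite /e; have := cos_le1 tau; lra.
exists e => // n W We phi X _ [_ cX dX].
pose x i (t : R) := X (Order.max t (- tau)) i 0.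
have xE i (t : R) : - tau <= t -> x i t = X t i 0.
  by move=> ht; rewrite /x; move/max_idPl : ht => ->.
have cx i : continuous (x i).
  move=> t; apply: (@continuous_comp _ _ _ _ (fun M : 'cV[R]_n => M i 0)).
    exact: (continuous_clamp cX).
  exact: coord_continuous.
pose f i t := \sum_j W i j * x j (t - tau).
have dx i (t : R) : 0 < t -> is_derive t (1 : R) (x i) (- x i (t - tau) + f i t).
  move=> t0; have := dX t i t0.
  have -> : (- (1%:M - W) *m X (t - tau)) i 0 = - x i (t - tau) + f i t.
    rewrite opprB mulmxBl mul1mx !mxE addrC xE ?lerBrDr ?addNr ?ltW//.
    congr (_ + _); apply: eq_bigr => j _; rewrite xE// lerBrDr addNr ltW//.
  apply: near_eq_is_derive; near=> s; rewrite xE// (@le_trans _ _ 0) ?oppr_le0// ltW//.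
  by near: s; apply: lt_nbhsr.
have ccos i : continuous (fun t : R => cos t * x i t).
  by move=> t; apply: continuousM; [exact: continuous_cos|exact: cx].
have csin i : continuous (fun t : R => sin t * x i t).
  by move=> t; apply: continuousM; [exact: continuous_sin|exact: cx].
have csqr i : continuous (fun t : R => x i t ^+ 2).
  by move=> t; apply: continuousM; exact: cx.
have [C dC] := choice (fun i => continuous_antiderivative (a := - tau) (fun t _ => ccos i t)).
have [S dS] := choice (fun i => continuous_antiderivative (a := - tau) (fun t _ => csin i t)).
have [J dJ] := choice (fun i => continuous_antiderivative (a := - tau) (fun t _ => csqr i t)).
have cder (F : R -> R) (dF t : R) : is_derive t 1 F dF -> {for t, continuous F}.
  by move=> [? _]; apply/differentiable_continuous/derivable1_diffP.
have cH i (t : R) : - tau <= t ->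
    {for t, continuous (fun t : R => cos t * x i t * S i t - sin t * x i t * C i t)}.
  move=> ht; apply: cvgB; apply: cvgM; [exact: ccos|exact: cder (dS i t ht)|
    exact: csin|exact: cder (dC i t ht)].
have [H dH] := choice (fun i => continuous_antiderivative (cH i)).
pose y (t : R) := \sum_i x i t ^+ 2.
have y0 t : 0 <= y t by apply: sumr_ge0 => i _; exact: sqr_ge0.
pose Js (t : R) := \sum_i J i t.
have dJs (t : R) : - tau <= t -> is_derive t 1 Js (y t).
  by move=> ht; apply: is_derive_bigsum => i; exact: dJ.
have cy : continuous y.
  by move=> t; apply: cvg_big => [|i _]; [exact: add_continuous|exact: csqr].
have cK : continuous (fun t : R => t * y t).
  by move=> t; apply: cvgM; [exact: cvg_id|exact: cy].
have [K dK] := continuous_antiderivative (a := - tau) (fun t _ => cK t).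
pose g := pi / 4 - tau / 2.
pose V i := delay_lyapunov tau g (x i) (C i) (S i) (H i).
pose M i t := delay_moment g (C i) (S i) t (t - tau).
pose P i t := cos g * x i t - M i t.
pose dV i t := - (cos tau * x i t ^+ 2) + 2 * (cos g * (P i t * f i t)).
have dVE i (t : R) : 0 < t -> is_derive t 1 (V i) (dV i t).
  move=> t0; apply: is_derive_delay_lyapunov => //; last exact: dx.
  exact: ltW.
have fle (t : R) : \sum_i f i t ^+ 2 <= e ^+ 2 * y (t - tau) by exact: We.
(* The forcing is split by Young's inequality with weight [e]; then [P^2 <= 2 x^2 + 2 M^2] and the
   bound on the moment turn [e P^2] into instantaneous and window terms. *)
have dV_le i (t : R) : 0 < t ->
    dV i t <= (2 * e - cos tau) * x i t ^+ 2
       + 4 * e * (J i t - J i (t - tau)) + e^-1 * f i t ^+ 2.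
  move=> t0.
  have hM : M i t ^+ 2 <= 2 * (J i t - J i (t - tau)).
    apply: (@delay_moment_sqr_le _ tau g (x i)) => //; first exact: ltW.
  have hP : P i t ^+ 2 <= 2 * x i t ^+ 2 + 2 * M i t ^+ 2.
    have := sqr_ge0 (cos g * x i t + M i t).
    have := mulr_ge0 (sqr_ge0 (sin g)) (sqr_ge0 (x i t)).
    by rewrite sin2cos2 /P; move: (x i t) (M i t) (cos g) => a b c; nra.
  have hq : 2 * (cos g * (P i t * f i t)) <= e * P i t ^+ 2 + e^-1 * f i t ^+ 2.
    have h1 : 0 <= e^-1 * (e * (cos g * P i t) - f i t) ^+ 2.
      by rewrite mulr_ge0 ?sqr_ge0// invr_ge0 ltW.
    have h2 := mulr_ge0 (ltW e0) (mulr_ge0 (sqr_ge0 (sin g)) (sqr_ge0 (P i t))).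
    apply: le_trans (_ : e * (cos g * P i t) ^+ 2 + e^-1 * f i t ^+ 2 <= _).
      rewrite -subr_ge0; apply: le_trans h1 _; rewrite le_eqVlt; apply/orP; left.
      by apply/eqP; field; rewrite gt_eqF.
    by move: h2; rewrite sin2cos2; move: (P i t) (cos g) => a b; nra.
  rewrite /dV; nra.
(* The bracket is the integral of [(s - (t - tau) + 1) * y s] over [t - tau, t]. *)
pose L (t : R) := \sum_i V i t +
  4 * e * (K t - K (t - tau) - (t - tau - 1) * (Js t - Js (t - tau))).
(* The weight decreases at unit rate in [t] and is [1] at the old end of the window. The resulting
   [- (Js t - Js (t - tau))] and [- y (t - tau)] absorb the moment terms and the coupling
   respectively. *)
pose L' (t : R) := \sum_i dV i t + 4 * e * ((tau + 1) * y t - y (t - tau) - (Js t - Js (t - tau))).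
have dL (t : R) : 0 < t -> is_derive t 1 L (L' t).
  move=> t0.
  have ht : - tau <= t by rewrite (le_trans _ (ltW t0))// oppr_le0.
  have htd : - tau <= t - tau by rewrite lerBrDr addNr ltW.
  have ? := dK t ht; have ? := dJs t ht.
  have ? := is_derive_delay (dK _ htd); have ? := is_derive_delay (dJs _ htd).
  have ? := is_derive_bigsum (fun i => dVE i t t0).
  by rewrite /L; apply: is_derive_eq; rewrite /L' /GRing.scale/=; ring.
have L'_le (t : R) : 0 < t -> L' t <= - (cos tau / 2 * y t).
  move=> t0.
  have : \sum_i dV i t <= (2 * e - cos tau) * y t
       + 4 * e * (Js t - Js (t - tau)) + e^-1 * \sum_i f i t ^+ 2.
    rewrite -sumrB !mulr_sumr -!big_split/=; apply: ler_sum => i _.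
    exact: dV_le.
  have : e^-1 * \sum_i f i t ^+ 2 <= e * y (t - tau).
    by rewrite ler_pdivrMl// mulrA -expr2.
  have -> : cos tau = 28 * e by rewrite /e; field.
  have := mulr_ge0 (mulr_ge0 (ltW e0) (y0 t)) tau2'.
  have := mulr_ge0 (ltW e0) (y0 (t - tau)).
  by rewrite /L'; move: (y t) (y (t - tau)) (Js t - _) => u v w; nra.
have L_ge0 (t : R) : 0 <= t -> 0 <= L t.
  move=> t0; apply: addr_ge0.
    apply: sumr_ge0 => i _; apply: delay_lyapunov_ge0 => //.
  apply: mulr_ge0; first by rewrite mulr_ge0// ltW.
  pose G s := (t - tau - 1) * Js s - K s.
  have : G t <= G (t - tau).
    apply: (@ge_of_is_derive _ G (fun s => (t - tau - 1) * y s - s * y s)).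
    - by rewrite gerBl.
    - move=> s /andP[ts st].
      have s_ge : - tau <= s by rewrite (le_trans _ ts)// lerBrDr addNr.
      have ? := dK s s_ge; have ? := dJs s s_ge.
      by rewrite /G; apply: is_derive_eq; rewrite /GRing.scale/=.
    - move=> s /andP[ts st]; rewrite -mulrBl mulr_le0_ge0//.
      by rewrite subr_le0 (le_trans _ ts)// gerBl.
  by rewrite /G; lra.
have c2 : 0 < cos tau / 2 by rewrite divr_gt0.
(* [L + cos tau / 2 * Js] is nonincreasing for positive times and [L] is nonnegative. The comparison
   starts at [1] since the equation is imposed only for [t > 0]. *)
pose B := (L 1 + cos tau / 2 * Js 1) / (cos tau / 2).
have JB (t : R) : 1 <= t -> Js t <= B.
  move=> t1; rewrite /B ler_pdivlMr//.
  have : L t + cos tau / 2 * Js t <= L 1 + cos tau / 2 * Js 1.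
    apply: (@ge_of_is_derive _ (fun s => L s + cos tau / 2 * Js s)
      (fun s => L' s + cos tau / 2 * y s)) => //.
      move=> s /andP[s1 _].
      have s0 : 0 < s by rewrite (lt_le_trans _ s1).
      have ? := dL s s0.
      have ? : is_derive s (1 : R) Js (y s).
        by apply: dJs; rewrite (le_trans _ (ltW s0))// oppr_le0.
      by apply: is_derive_eq.
    move=> s /andP[s1 _]; rewrite -lerBrDr sub0r; apply: L'_le.
    by rewrite (lt_le_trans _ s1).
  have := L_ge0 t (le_trans ler01 t1).
  by rewrite [in X in _ -> _ -> X]mulrC; lra.
(* Integrability of [y] alone does not force decay. The equation also gives
   [y' <= y + 4 y(t - tau)], and this is the integrated form. *)
have osc (s t : R) : 1 <= s -> s <= t ->
    y t <= y s + (Js t - Js s) + 4 * (Js (t - tau) - Js (s - tau)).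
  move=> s1 st.
  pose U (s : R) := y s - Js s - 4 * Js (s - tau).
  suff : U t <= U s by rewrite /U; lra.
  apply: (@ge_of_is_derive _ U (fun s : R =>
    \sum_i 2 * (x i s * (- x i (s - tau) + f i s)) - y s - 4 * y (s - tau))) => //.
    move=> u /andP[su _].
    have u0 : 0 < u by rewrite (lt_le_trans _ su)// (lt_le_trans _ s1).
    have u_ge : - tau <= u by rewrite (le_trans _ (ltW u0))// oppr_le0.
    have ud_ge : - tau <= u - tau by rewrite lerBrDr addNr ltW.
    have ? := dJs u u_ge; have ? := is_derive_delay (dJs _ ud_ge).
    have ? : is_derive u (1 : R) y (\sum_i 2 * (x i u * (- x i (u - tau) + f i u))).
      apply: is_derive_bigsum => i; have ? := dx i u u0.
      by apply: is_derive_eq; rewrite /GRing.scale/=; ring.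
    by rewrite /U; apply: is_derive_eq.
  move=> u _.
  have : \sum_i 2 * (x i u * (- x i (u - tau) + f i u)) <=
      y u + 2 * y (u - tau) + 2 * \sum_i f i u ^+ 2.
    rewrite !mulr_sumr -!big_split/=; apply: ler_sum => i _.
    move: (x i u) (x i (u - tau)) (f i u) => a b c.
    have := sqr_ge0 (a + b - c); have := sqr_ge0 (b + c); nra.
  have e21 : e ^+ 2 <= 1 by rewrite expr_le1// ltW.
  have := le_trans (fle u) (ler_wpM2r (y0 (u - tau)) e21).
  by rewrite mul1r; lra.
apply/cvg_ex; exists 0; apply: cvg_col_sqr => r r0.
have [N hN] := bounded_primitive_vanishes tau0 dJs y0 JB osc r0.
exists (Order.max N 0) => t; rewrite ge_max => /andP[Nt t0].
apply: le_trans (hN t Nt); rewrite le_eqVlt; apply/orP; left; apply/eqP.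
by apply: eq_bigr => i _; rewrite xE// (le_trans _ t0)// oppr_le0.
Unshelve. all: by end_near.
Qed.

(** * Independence *)

Definition bounded_mfun (d : measure_display) (T : measurableType d)
    (R : realType) (f : T -> R) : Prop :=
  measurable_fun [set: T] f /\ exists M, forall x, `|f x| <= M.

Section bounded_mfun_theory.
Context (d : measure_display) (T : measurableType d) (R : realType).
Implicit Types (f g : T -> R) (A : set T).

Lemma bounded_mfun_cst (c : R) : bounded_mfun (fun _ : T => c).
Proof. by split; [exact: measurable_cst|exists `|c|]. Qed.

Lemma bounded_mfunD f g : bounded_mfun f -> bounded_mfun g ->
  bounded_mfun (fun x => f x + g x).
Proof.
move=> [mf [M fM]] [mg [N gN]]; split; first exact: measurable_funD.
by exists (M + N) => x; rewrite (le_trans (ler_normD _ _))// lerD.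
Qed.

Lemma bounded_mfunM f g : bounded_mfun f -> bounded_mfun g ->
  bounded_mfun (fun x => f x * g x).
Proof.
move=> [mf [M fM]] [mg [N gN]]; split; first exact: measurable_funM.
by exists (M * N) => x; rewrite normrM ler_pM.
Qed.

Lemma bounded_mfunZ (c : R) f : bounded_mfun f -> bounded_mfun (fun x => c * f x).
Proof. exact/bounded_mfunM/bounded_mfun_cst. Qed.

Lemma bounded_mfunB f g : bounded_mfun f -> bounded_mfun g ->
  bounded_mfun (fun x => f x - g x).
Proof.
move=> bf /(bounded_mfunZ (-1)) bg.
rewrite (_ : (fun x => _) = (fun x => f x + -1 * g x)); first exact: bounded_mfunD.
by apply/funext => x; rewrite mulN1r.
Qed.

Lemma bounded_mfun_indic A : measurable A -> bounded_mfun (\1_A : T -> R).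
Proof.
move=> mA; split; first exact: measurable_indic.
by exists 1 => x; rewrite indicE ger0_norm ?ler0n// lern1 leq_b1.
Qed.

Lemma bounded_mfun_sum (I : Type) (s : seq I) (D : pred I) (F : I -> T -> R) :
  (forall i, D i -> bounded_mfun (F i)) ->
  bounded_mfun (fun x => \sum_(i <- s | D i) F i x).
Proof.
move=> bF; elim: s => [|i s ih].
  rewrite [X in bounded_mfun X](_ : _ = fun=> 0); first exact: (bounded_mfun_cst 0).
  by apply/funext => x; rewrite big_nil.
case: (boolP (D i)) => [Di|/negbTE Di]; last first.
  by under [X in bounded_mfun X]eq_fun do rewrite big_cons Di.
under [X in bounded_mfun X]eq_fun do rewrite big_cons Di.
by apply: bounded_mfunD => //; exact: bF.
Qed.

Lemma bounded_mfun_prod (I : Type) (s : seq I) (D : pred I) (F : I -> T -> R) :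
  (forall i, D i -> bounded_mfun (F i)) ->
  bounded_mfun (fun x => \prod_(i <- s | D i) F i x).
Proof.
move=> bF; elim: s => [|i s ih].
  rewrite [X in bounded_mfun X](_ : _ = fun=> 1); first exact: (bounded_mfun_cst 1).
  by apply/funext => x; rewrite big_nil.
case: (boolP (D i)) => [Di|/negbTE Di]; last first.
  by under [X in bounded_mfun X]eq_fun do rewrite big_cons Di.
under [X in bounded_mfun X]eq_fun do rewrite big_cons Di.
by apply: bounded_mfunM => //; exact: bF.
Qed.

End bounded_mfun_theory.

Lemma bounded_mfun_comp (d d' : measure_display) (T : measurableType d)
    (U : measurableType d') (R : realType) (f : U -> R) (X : T -> U) :
  bounded_mfun f -> measurable_fun [set: T] X -> bounded_mfun (fun w => f (X w)).
Proof.
by move=> [mf [M fM]] mX; split; [exact: measurableT_comp|exists M].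
Qed.

Section bounded_expectation.
Context (d : measure_display) (T : measurableType d) (R : realType)
  (P : probability T R).
Implicit Types (f g : T -> R).

Lemma bounded_mfun_integrable f : bounded_mfun f ->
  P.-integrable [set: T] (EFin \o f).
Proof.
move=> [mf [M fM]]; apply: measurable_bounded_integrable => //.
  by rewrite (le_lt_trans (probability_le1 _ _)) ?ltry.
exists M; split; first exact: num_real.
by move=> N MN x _; apply: (le_trans (fM x)); exact: ltW.
Qed.

Lemma mean_cst (c : R) : (\int[P]_w c)%R = c.
Proof. by rewrite Rintegral_cst// [X in _ * X](congr1 fine (probability_setT P)) mulr1. Qed.

Lemma meanD f g : bounded_mfun f -> bounded_mfun g ->
  (\int[P]_w (f w + g w) = \int[P]_w f w + \int[P]_w g w)%R.
Proof. by move=> bf bg; rewrite RintegralD//; exact: bounded_mfun_integrable. Qed.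

Lemma meanB f g : bounded_mfun f -> bounded_mfun g ->
  (\int[P]_w (f w - g w) = \int[P]_w f w - \int[P]_w g w)%R.
Proof. by move=> bf bg; rewrite RintegralB//; exact: bounded_mfun_integrable. Qed.

Lemma meanZ (c : R) f : bounded_mfun f ->
  (\int[P]_w (c * f w) = c * \int[P]_w f w)%R.
Proof. by move=> bf; rewrite RintegralZl//; exact: bounded_mfun_integrable. Qed.

Lemma mean_le f g : bounded_mfun f -> bounded_mfun g ->
  (forall w, f w <= g w) -> (\int[P]_w f w <= \int[P]_w g w)%R.
Proof. by move=> bf bg fg; apply: le_Rintegral => //; exact: bounded_mfun_integrable. Qed.

Lemma mean_sum (I : Type) (s : seq I) (D : pred I) (F : I -> T -> R) :
  (forall i, D i -> bounded_mfun (F i)) ->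
  (\int[P]_w (\sum_(i <- s | D i) F i w) =
   \sum_(i <- s | D i) \int[P]_w F i w)%R.
Proof.
move=> bF; elim: s => [|i s ih].
  by under eq_Rintegral do rewrite big_nil; rewrite mean_cst big_nil.
rewrite [RHS]big_cons; case: ifPn => [Di|/negbTE Di]; last first.
  by under eq_Rintegral do rewrite big_cons Di.
under eq_Rintegral do rewrite big_cons Di.
by rewrite meanD ?ih//; [exact: bF|exact: bounded_mfun_sum].
Qed.

Lemma mean_indic (A : set T) : measurable A -> (\int[P]_w \1_A w)%R = fine (P A).
Proof. by move=> mA; rewrite /Rintegral integral_indic// setIT. Qed.

Lemma mean_norm_le f (M : R) : bounded_mfun f -> (forall w, `|f w| <= M) ->
  `|(\int[P]_w f w)%R| <= M.
Proof.
move=> bf fM; rewrite ler_norml; apply/andP; split.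
  rewrite -[leLHS]mean_cst; apply: mean_le => // [|w]; first exact: bounded_mfun_cst.
  by have := fM w; rewrite ler_norml => /andP[].
rewrite -[leRHS]mean_cst; apply: mean_le => // [|w]; first exact: bounded_mfun_cst.
by have := fM w; rewrite ler_norml => /andP[].
Qed.

End bounded_expectation.

(* Rounding down: the left-hand sum is [Num.floor y], written as a combination
   of indicators of superlevel sets. *)
Lemma layer_sum_bounds (R : realType) (m : nat) (y : R) : 0 <= y -> y <= m%:R ->
  let l := \sum_(k < m) (((k.+1%:R : R) <= y)%R%:R : R) in l <= y /\ y <= l + 1.
Proof.
move=> y0; elim: m => [|m ih] ym /=; first by rewrite big_ord0; lra.
rewrite big_ord_recr/=; have [ymm|mym] := leP y m%:R.
  rewrite [m.+1%:R <= y]leNgt (le_lt_trans ymm) ?ltr_nat//= addr0.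
  exact: ih.
rewrite (eq_bigr (fun=> 1)); last first.
  by move=> k _; rewrite (le_trans _ (ltW mym))// ler_nat.
rewrite sumr_const card_ord; case: (leP m.+1%:R y) => h.
  by move: ym h; rewrite -natr1 /=; split; lra.
by move: h mym; rewrite -natr1 /=; split; lra.
Qed.

(** Plays the part of a monotone class argument: with [Phi] the difference of two sides, an identity
    between means passes from indicators to bounded functions. A bounded function is a uniform limit
    of combinations of indicators of its superlevel sets, and [Phi] is continuous for the uniform
    norm. *)
Lemma functional_eq0_of_indic (d : measure_display) (U : measurableType d)
    (R : realType) (Phi : (U -> R) -> R) (c : R) :
  (forall f g, bounded_mfun f -> bounded_mfun g ->
     Phi (fun x => f x + g x) = Phi f + Phi g) ->
  (forall a f, bounded_mfun f -> Phi (fun x => a * f x) = a * Phi f) ->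
  (forall f M, bounded_mfun f -> (forall x, `|f x| <= M) -> `|Phi f| <= c * M) ->
  (forall A, measurable A -> Phi (\1_A) = 0) ->
  forall f, bounded_mfun f -> Phi f = 0.
Proof.
move=> PhiD PhiZ Phib Phi1 f bf; have [mf [M0 fM0]] := bf.
pose M := `|M0| + 1.
have M_gt0 : 0 < M by rewrite ltr_wpDl.
have fM x : `|f x| <= M by rewrite (le_trans (fM0 x))// ler_wpDr// ler_norm.
have Phi_cst a : Phi (fun=> a) = 0.
  rewrite (_ : (fun=> a) = (fun x => a * \1_[set: U] x)).
    by rewrite PhiZ ?Phi1 ?mulr0//; exact: bounded_mfun_indic.
  by apply/funext => x; rewrite indicT mulr1.
have Phi_sum (I : Type) (s : seq I) (F : I -> U -> R) :
    (forall i, bounded_mfun (F i)) -> (forall i, Phi (F i) = 0) ->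
    Phi (fun x => \sum_(i <- s) F i x) = 0.
  move=> bF F0; elim: s => [|i s ih]; first by under eq_fun do rewrite big_nil.
  under eq_fun do rewrite big_cons.
  by rewrite PhiD// ?ih ?F0 ?addr0//; exact: bounded_mfun_sum.
apply/eqP; rewrite -normr_le0; apply/ler_addgt0Pr => e e0; rewrite add0r.
have c0 : 0 <= c.
  have := Phib _ 1 (bounded_mfun_cst _ 1) _.
  by rewrite Phi_cst normr0 mulr1; apply => x; rewrite normr1.
(* Number of levels between [- M] and [M], large enough that [c] times the mesh [q] is at most
   [e]. *)
pose m := (Num.truncn (c * (2 * M) / e)).+1.
have m0 : 0 < (m%:R : R) by rewrite ltr0n.
have mE : c * (2 * M / m%:R) <= e.
  have := truncnS_gt (c * (2 * M) / e); rewrite -/m ltr_pdivrMr// => h.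
  by rewrite mulrA ler_pdivrMr// [e * _]mulrC ltW.
pose q := 2 * M / m%:R.
have q0 : 0 < q by rewrite divr_gt0// mulr_gt0.
pose h (k : 'I_m) : set U := [set x | k.+1%:R * q - M <= f x].
have mh k : measurable (h k).
  rewrite (_ : h k = f @^-1` `[k.+1%:R * q - M, +oo[); last first.
    by apply/seteqP; split => x; rewrite /h /= in_itv/= andbT.
  by rewrite -[X in measurable X]setTI; exact: mf.
(* [f] rounded down to the grid of mesh [q] starting at [- M]. *)
pose g x := - M + q * \sum_k (\1_(h k) x : R).
have bg1 : bounded_mfun (fun x => \sum_k (\1_(h k) x : R)).
  by apply: bounded_mfun_sum => k _; exact: bounded_mfun_indic.
have bg : bounded_mfun g.
  by apply: bounded_mfunD; [exact: bounded_mfun_cst|exact: bounded_mfunZ].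
have Phig : Phi g = 0.
  rewrite /g PhiD ?Phi_cst ?add0r ?PhiZ ?Phi_sum ?mulr0//.
  - by move=> k; exact: bounded_mfun_indic.
  - by move=> k; exact: Phi1.
  - exact: bounded_mfun_cst.
  - exact: bounded_mfunZ.
have -> : Phi f = Phi (fun x => f x - g x).
  rewrite [in LHS](_ : f = fun x => (f x - g x) + g x); last first.
    by apply/funext => x; rewrite subrK.
  by rewrite PhiD ?Phig ?addr0//; exact: bounded_mfunB.
rewrite (le_trans _ mE)//; apply: Phib; first exact: bounded_mfunB.
move=> x.
have y0 : 0 <= (f x + M) / q.
  by rewrite divr_ge0// ?(ltW q0)//; have := fM x; rewrite ler_norml; lra.
have ym : (f x + M) / q <= m%:R.
  rewrite ler_pdivrMr// /q mulrC divfK ?gt_eqF//.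
  by have := fM x; rewrite ler_norml; lra.
have [] := layer_sum_bounds y0 ym.
rewrite (eq_bigr (fun k => \1_(h k) x)); last first.
  move=> k _; rewrite indicE ler_pdivlMr// -lerBlDr; congr (_%:R).
  by rewrite /h; apply/esym; case: (boolP (_ <= _)) => hk;
    [rewrite mem_set|rewrite memNset//; exact/negP].
rewrite ler_pdivlMr// ler_pdivrMr// mulrDl mul1r.
by rewrite -/q /g ler_norml; move: (\sum_k _) => l; lra.
Qed.

(** * Product formula for functions of independent entries *)

Definition gated (T : Type) (R : realType) (b : T -> bool) (r : T -> R) (w : T) : R :=
  if b w then r w else 0.

Lemma measurable_gated (d : measure_display) (T : measurableType d)
    (R : realType) (P : probability T R) (b : {RV P >-> bool}) (r : {RV P >-> R}) :
  measurable_fun [set: T] (gated b r).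
Proof. by apply: measurable_fun_ifT => //; exact: measurable_cst. Qed.

Section gated_independence.
Context (d : measure_display) (T : measurableType d) (R : realType)
  (P : probability T R) (K : finType) (D : pred K).
Variables (b : K -> {RV P >-> bool}) (r : K -> {RV P >-> R}).
Hypothesis indep : forall (A : K -> set bool) (C : K -> set R),
  (forall k, measurable (A k)) -> (forall k, measurable (C k)) ->
  P (\bigcap_(k in [set k | D k]) (b k @^-1` A k `&` r k @^-1` C k)) =
  (\prod_(k | D k) (P (b k @^-1` A k) * P (r k @^-1` C k)))%E.

Let cell k (A : set bool) (C : set R) := b k @^-1` A `&` r k @^-1` C.

Let measurable_b k (A : set bool) : measurable (b k @^-1` A).
Proof. exact: measurable_funPTI. Qed.

Let measurable_r k (C : set R) : measurable C -> measurable (r k @^-1` C).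
Proof. exact: measurable_funPTI. Qed.

Let measurable_cell k A C : measurable C -> measurable (cell k A C).
Proof. by move=> mC; apply: measurableI => //; exact: measurable_r. Qed.

(** The independence hypothesis is applied with full sets at every coordinate other than [k]. *)
Lemma prob_cell k A C : D k -> measurable C ->
  P (cell k A C) = (P (b k @^-1` A) * P (r k @^-1` C))%E.
Proof.
move=> Dk mC.
have := @indep (fun j => if j == k then A else setT) (fun j => if j == k then C else setT).
rewrite (bigD1 k)//= eqxx big1 ?mule1; last first.
  by move=> j /andP[_ /negbTE ->]; rewrite !preimage_setT probability_setT mule1.
move=> <-//; last by move=> j; case: ifP.
congr (P _); apply/seteqP; split => [w [wA wC] j /= _|w /(_ k Dk)/=].
  by case: eqP => [->|].
by rewrite eqxx.
Qed.

Lemma mean_prod_cell (A : K -> set bool) (C : K -> set R) :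
  (forall k, measurable (C k)) ->
  (\int[P]_w (\prod_(k | D k) \1_(cell k (A k) (C k)) w) =
   \prod_(k | D k) \int[P]_w \1_(cell k (A k) (C k)) w)%R.
Proof.
move=> mC.
have E k : D k -> (\int[P]_w \1_(cell k (A k) (C k)) w)%R =
    fine (P (b k @^-1` A k)) * fine (P (r k @^-1` C k)).
  move=> Dk; rewrite mean_indic; last exact: measurable_cell.
  rewrite prob_cell// fineM//; apply: fin_num_measure; first exact: measurable_b.
  exact: measurable_r.
rewrite (eq_bigr _ E).
have mI : measurable (\bigcap_(k in [set k | D k]) cell k (A k) (C k)).
  by apply: fin_bigcap_measurable => // k _; exact: measurable_cell.
transitivity (\int[P]_w \1_(\bigcap_(k in [set k | D k]) cell k (A k) (C k)) w)%R.
  apply: eq_Rintegral => w _; rewrite indicE.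
  have [wI|wI] := pselect ((\bigcap_(k in [set k | D k]) cell k (A k) (C k)) w).
    by rewrite mem_set// big1// => k Dk; rewrite indicE mem_set//; exact: wI.
  rewrite memNset//; have [k Dk wk] : exists2 k, D k & ~ cell k (A k) (C k) w.
    apply: contrapT => h; apply: wI => k Dk; apply: contrapT => wk; apply: h.
    by exists k.
  by rewrite (bigD1 k)//= indicE memNset// mul0r.
rewrite mean_indic//.
have -> : P (\bigcap_(k in [set k | D k]) cell k (A k) (C k)) =
    (\prod_(k | D k) (fine (P (b k @^-1` A k)) * fine (P (r k @^-1` C k)))%:E)%E.
  rewrite indep//; apply: eq_bigr => k Dk; rewrite EFinM !fineK//.
    by apply: fin_num_measure; exact: measurable_r.
  by apply: fin_num_measure; exact: measurable_b.
by rewrite prodEFin.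
Qed.

Let bounded_cell k A C : measurable C ->
  bounded_mfun (\1_(cell k A C) : T -> R).
Proof. by move=> mC; apply: bounded_mfun_indic; exact: measurable_cell. Qed.

Let gated_cells k (F : R -> R) w : F (gated (b k) (r k) w) =
  \1_(cell k [set true] setT) w * F (r k w) +
  F 0 * \1_(cell k [set false] setT) w.
Proof.
rewrite /gated; case: ifP => bw.
  rewrite !indicE mem_set ?memNset ?mulr0 ?addr0 ?mul1r//.
  by case; rewrite /= bw.
rewrite !indicE memNset ?mem_set ?mulr1 ?mul0r ?add0r//.
by case; rewrite /= bw.
Qed.

(** Exchanges one cell indicator for a bounded function of the same entry. In its use below, [G] is
    the product of the other factors and [p] the product of their means. *)
Let mean_gated_factor k (G : T -> R) (p : R) : bounded_mfun G ->
  (forall A C, measurable C ->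
    (\int[P]_w (\1_(cell k A C) w * G w) = p * \int[P]_w \1_(cell k A C) w)%R) ->
  forall F : R -> R, bounded_mfun F ->
  (\int[P]_w (F (gated (b k) (r k) w) * G w) =
   p * \int[P]_w F (gated (b k) (r k) w))%R.
Proof.
move=> bG cellE F bF.
pose I : T -> R := \1_(cell k [set true] setT).
have bI : bounded_mfun I by exact: bounded_cell.
have br (f : R -> R) : bounded_mfun f -> bounded_mfun (fun w => f (r k w)).
  by move=> bf; apply: bounded_mfun_comp bf _; exact: measurable_funPT.
have bIr (f : R -> R) : bounded_mfun f -> bounded_mfun (fun w => I w * f (r k w)).
  by move=> /br; exact: bounded_mfunM.
have bIrG (f : R -> R) : bounded_mfun f ->
    bounded_mfun (fun w => I w * f (r k w) * G w).
  by move=> /bIr bf; exact: bounded_mfunM.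
(* The defect of factorization on the connected part; on the disconnected part [F] is the constant
   [F 0], so the hypothesis on cells applies directly. *)
pose Phi (f : R -> R) := (\int[P]_w (I w * f (r k w) * G w)
  - p * \int[P]_w (I w * f (r k w)))%R.
have [_ [N GN]] := bG.
have N0 : 0 <= N by rewrite (le_trans _ (GN point)).
have Phi0 f : bounded_mfun f -> Phi f = 0.
  apply: (@functional_eq0_of_indic _ _ _ Phi (N + `|p|)) => {f}.
  - move=> f g bf bg; rewrite /Phi.
    under eq_Rintegral do rewrite mulrDr mulrDl.
    rewrite meanD; [|exact: bIrG|exact: bIrG].
    under [X in _ - p * X]eq_Rintegral do rewrite mulrDr.
    by rewrite meanD; [ring|exact: bIr|exact: bIr].
  - move=> a f bf; rewrite /Phi.
    under eq_Rintegral do rewrite mulrCA -mulrA.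
    rewrite meanZ; last exact: bIrG.
    under [X in _ - p * X]eq_Rintegral do rewrite mulrCA.
    by rewrite meanZ; [ring|exact: bIr].
  - move=> f M bf fM.
    have If w : `|I w * f (r k w)| <= M.
      rewrite normrM (le_trans _ (fM (r k w)))// ler_piMl//.
      by rewrite /I indicE ger0_norm ?ler0n// lern1 leq_b1.
    rewrite /Phi (le_trans (ler_normB _ _))// mulrDl lerD//.
      apply: mean_norm_le => [|w]; first exact: bIrG.
      by rewrite normrM mulrC ler_pM.
    by rewrite normrM ler_wpM2l//; apply: mean_norm_le => //; exact: bIr.
  - move=> C mC; rewrite /Phi.
    have IE w : I w * \1_C (r k w) = \1_(cell k [set true] C) w :> R.
      by rewrite /I /cell preimage_setT setIT indicI; congr (_ * _).
    under eq_Rintegral do rewrite IE.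
    under [X in _ - p * X]eq_Rintegral do rewrite IE.
    by rewrite cellE// subrr.
under eq_Rintegral do rewrite gated_cells mulrDl.
under [in RHS]eq_Rintegral do rewrite gated_cells.
have bJ : bounded_mfun (fun w => F 0 * (\1_(cell k [set false] setT) w : R)).
  by apply: bounded_mfunZ; exact: bounded_cell.
rewrite !meanD//; [|exact: bIr|exact: bIrG|exact: bounded_mfunM].
have /eqP := Phi0 F bF; rewrite subr_eq0 => /eqP ->.
under [X in _ + X = _]eq_Rintegral do rewrite -mulrA.
have bc : bounded_mfun (\1_(cell k [set false] setT) : T -> R) by exact: bounded_cell.
rewrite !meanZ ?cellE//; [by ring|exact: bounded_mfunM].
Qed.

Lemma mean_prod_gated (F : K -> R -> R) : (forall k, bounded_mfun (F k)) ->
  (\int[P]_w (\prod_(k | D k) F k (gated (b k) (r k) w)) =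
   \prod_(k | D k) \int[P]_w F k (gated (b k) (r k) w))%R.
Proof.
move=> bF.
(* Induction on the set [S] of coordinates at which the indicator of a cell has
   already been replaced by an arbitrary bounded function. *)
pose good (S : seq K) (f : K -> T -> R) := forall k,
  if k \in S then exists2 G, bounded_mfun G & f k = fun w => G (gated (b k) (r k) w)
  else exists A, exists2 C, measurable C & f k = \1_(cell k A C).
suff main (S : seq K) (f : K -> T -> R) : good S f ->
    (\int[P]_w (\prod_(k | D k) f k w) = \prod_(k | D k) \int[P]_w f k w)%R.
  apply: (main (enum K)) => k; rewrite mem_enum inE; by exists (F k).
elim: S f => [|a S ih] f gf.
  have {}gf k : exists AC : set bool * set R, measurable AC.2 /\ f k = \1_(cell k AC.1 AC.2).
    by have [A [C mC ->]] := gf k; exists (A, C).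
  have [AC hAC] := choice gf.
  under eq_Rintegral do under eq_bigr do rewrite (hAC _).2.
  rewrite mean_prod_cell; last by move=> k; exact: (hAC k).1.
  by apply: eq_bigr => k _; rewrite (hAC k).2.
have bf k : bounded_mfun (f k).
  have := gf k; case: ifP => _.
    move=> [G bG ->]; apply: (bounded_mfun_comp bG); exact: measurable_gated.
  by move=> [A [C mC ->]]; exact: bounded_cell.
have good_upd (h : T -> R) :
    (a \notin S -> exists A, exists2 C, measurable C & h = \1_(cell a A C)) ->
    a \notin S -> good S (fun k => if k == a then h else f k).
  move=> hh aS k; case: eqVneq => [->|ka]; first by rewrite (negbTE aS); exact: hh.
  by have := gf k; rewrite inE (negbTE ka).
have [aS|aS] := boolP (a \in S).
  apply: ih => k; have := gf k; rewrite inE.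
  by case: eqVneq => [->|]//=; rewrite aS.
have upd (h : T -> R) k : k != a -> (if k == a then h else f k) = f k by move=> /negbTE ->.
(* A coordinate outside [D] occurs in neither product, so a full cell can be put there to meet the
   induction hypothesis. *)
have [Da|Da] := boolP (D a); last first.
  have Dka k : D k -> k != a by apply: contraTneq => ->.
  have := ih _ (good_upd \1_(cell a setT setT)
    (fun _ => ex_intro _ setT (ex_intro2 _ _ setT measurableT erefl)) aS).
  under eq_Rintegral do under eq_bigr => k Dk do rewrite (upd _ _ (Dka k Dk)).
  move=> ->; apply: eq_bigr => k Dk.
  by rewrite (upd _ _ (Dka k Dk)).
under eq_Rintegral do rewrite (bigD1 a)//=.
rewrite [RHS](bigD1 a)//= [RHS]mulrC.
have := gf a; rewrite inE eqxx/= => -[G bG fa].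
rewrite fa; apply: mean_gated_factor => //.
  by apply: bounded_mfun_prod => k _; exact: bf.
move=> A C mC.
(* The factorization on cells is the induction hypothesis for the family whose coordinate [a] is
   reset to a cell indicator. *)
have := ih _ (good_upd \1_(cell a A C)
  (fun _ => ex_intro _ A (ex_intro2 _ _ C mC erefl)) aS).
under eq_Rintegral do rewrite (bigD1 a)//= eqxx.
rewrite (bigD1 a)//= eqxx [RHS]mulrC => h.
rewrite -[X in _ = X * _](@eq_bigr _ _ _ _ _ _
  (fun k => \int[P]_w (if k == a then \1_(cell a A C) else f k) w)); last first.
  by move=> k /andP[_ ka]; rewrite (upd _ _ ka).
rewrite -h; apply: eq_Rintegral => w _; congr (_ * _).
by apply: eq_bigr => k /andP[_ ka]; rewrite (upd _ _ ka).
Qed.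

End gated_independence.

(** * Operator norm of the interaction matrix *)

Lemma cauchy_schwarz_sum (R : realFieldType) (I : finType) (a b : I -> R) :
  (\sum_i a i * b i) ^+ 2 <= (\sum_i a i ^+ 2) * \sum_i b i ^+ 2.
Proof.
rewrite expr2 !big_distrlr/=.
have -> : \sum_i \sum_j a i ^+ 2 * b j ^+ 2 =
    2^-1 * (\sum_i \sum_j a i ^+ 2 * b j ^+ 2 + \sum_i \sum_j a j ^+ 2 * b i ^+ 2).
  by rewrite [X in _ + X]exchange_big/=; field.
rewrite -big_split mulr_sumr; apply: ler_sum => i _ /=.
rewrite -big_split mulr_sumr; apply: ler_sum => j _ /=.
have := sqr_ge0 (a i * b j - a j * b i).
move: (a i) (a j) (b i) (b j) => x y z t; nra.
Qed.

(** [|x u|^2] is the Frobenius product of [x^T x] and [u u^T], and Cauchy-Schwarz bounds it by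
    [|x^T x|_F |u|^2]. For centered entries this is much sharper than the Frobenius norm of [x]. *)
Lemma gram_bound (R : realFieldType) (n : nat) (x : 'I_n -> 'I_n -> R) (g : R) :
  0 <= g -> \sum_j \sum_l (\sum_i x i j * x i l) ^+ 2 <= g ^+ 2 ->
  forall u : 'I_n -> R,
    \sum_i (\sum_j x i j * u j) ^+ 2 <= g * \sum_j u j ^+ 2.
Proof.
move=> g0 xg u.
have u0 : 0 <= \sum_j u j ^+ 2 by apply: sumr_ge0 => j _; exact: sqr_ge0.
have E : \sum_i (\sum_j x i j * u j) ^+ 2 =
    \sum_(q : 'I_n * 'I_n) (\sum_i x i q.1 * x i q.2) * (u q.1 * u q.2).
  rewrite -(pair_bigA _ (fun j l => (\sum_i x i j * x i l) * (u j * u l)))/=.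
  under eq_bigr do rewrite expr2 big_distrlr/=.
  rewrite exchange_big/=; apply: eq_bigr => j _.
  rewrite exchange_big/=; apply: eq_bigr => l _.
  by rewrite mulr_suml; apply: eq_bigr => i _; ring.
have gu0 : 0 <= g * \sum_j u j ^+ 2 by rewrite mulr_ge0.
rewrite -ler_sqr ?nnegrE//; last by apply: sumr_ge0 => i _; exact: sqr_ge0.
rewrite E (le_trans (cauchy_schwarz_sum _ _))//.
rewrite -(pair_bigA _ (fun j l => (\sum_i x i j * x i l) ^+ 2))/=.
rewrite exprMn ler_pM//.
- by apply: sumr_ge0 => j _; apply: sumr_ge0 => l _; exact: sqr_ge0.
- by apply: sumr_ge0 => q _; exact: sqr_ge0.
rewrite -(pair_bigA _ (fun j l => (u j * u l) ^+ 2))/= [leRHS]expr2 big_distrlr/=.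
by apply: ler_sum => j _; apply: ler_sum => l _; rewrite exprMn.
Qed.

(** Deterministic part. The centered, constant and tail pieces each have squared operator norm at
    most [eta n^2]; a square of three summands costs a factor 3, whence [9 eta n^2], and dividing by
    row sums at least [c n] removes [n]. *)
Lemma interaction_matrix_bound (R : realType) (n : nat) (S : 'M[R]_n)
    (x z : 'I_n -> 'I_n -> R) (m eta c : R) : 0 <= eta -> 0 < c ->
  (forall i j, S i j = if i == j then 0 else x i j + m + z i j) ->
  (forall i, x i i = 0) -> (forall i, z i i = 0) ->
  m ^+ 2 <= eta ->
  \sum_i \sum_j z i j ^+ 2 <= eta * n%:R ^+ 2 ->
  \sum_j \sum_l (\sum_i x i j * x i l) ^+ 2 <= (eta * n%:R ^+ 2) ^+ 2 ->
  (forall i, c * n%:R <= \sum_k `|S i k|) ->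
  forall u : 'I_n -> R,
    \sum_i (\sum_j interaction_matrix S i j * u j) ^+ 2 <=
    9 * eta / c ^+ 2 * \sum_j u j ^+ 2.
Proof.
move=> eta0 c0 SE x0 z0 m_eta z_eta x_eta rows u.
case: n S x z SE x0 z0 z_eta x_eta rows u => [|n] S x z SE x0 z0 z_eta x_eta rows u.
  by rewrite !big_ord0 mulr0.
set N : R := n.+1%:R in z_eta x_eta rows *.
have N0 : 0 < N by rewrite /N ltr0n.
set U := \sum_j u j ^+ 2.
have U0 : 0 <= U by apply: sumr_ge0 => j _; exact: sqr_ge0.
have xu : \sum_i (\sum_j x i j * u j) ^+ 2 <= eta * N ^+ 2 * U.
  by apply: gram_bound => //; rewrite mulr_ge0// sqr_ge0.
have zu : \sum_i (\sum_j z i j * u j) ^+ 2 <= eta * N ^+ 2 * U.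
  apply: le_trans (_ : \sum_i (\sum_j z i j ^+ 2) * U <= _).
    by apply: ler_sum => i _; exact: cauchy_schwarz_sum.
  by rewrite -mulr_suml ler_wpM2r.
(* Cauchy-Schwarz in each row against the indicator of [j != i], whose squared norm is at most
   [N]. *)
have mu : \sum_i (\sum_(j | j != i) m * u j) ^+ 2 <= eta * N ^+ 2 * U.
  apply: le_trans (_ : \sum_(i < n.+1) N * (eta * U) <= _); last first.
    rewrite sumr_const card_ord -mulr_natl -/N le_eqVlt; apply/orP; left.
    by apply/eqP; ring.
  apply: ler_sum => i _.
  rewrite -mulr_sumr exprMn [leRHS]mulrCA ler_pM ?sqr_ge0// -/U.
  rewrite big_mkcond/= (eq_bigr (fun j => (j != i)%:R * u j)); last first.
    by move=> j _; case: ifP; rewrite ?mul1r ?mul0r.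
  rewrite (le_trans (cauchy_schwarz_sum _ _))// ler_wpM2r//.
  rewrite (_ : N = \sum_(j < n.+1) 1); last by rewrite sumr_const card_ord.
  by apply: ler_sum => j _; case: (_ != _); rewrite ?expr1n// expr0n.
have rowE i : \sum_j interaction_matrix S i j * u j =
    (\sum_k `|S i k|)^-1 *
    (\sum_j x i j * u j + \sum_(j | j != i) m * u j + \sum_j z i j * u j).
  have -> : \sum_j x i j * u j = \sum_(j | j != i) x i j * u j.
    by rewrite (bigD1 i)//= x0 mul0r add0r.
  have -> : \sum_j z i j * u j = \sum_(j | j != i) z i j * u j.
    by rewrite (bigD1 i)//= z0 mul0r add0r.
  rewrite -!big_split/= mulr_sumr (bigD1 i)//= mxE eqxx mul0r add0r.
  apply: eq_bigr => j ji; rewrite mxE eq_sym (negbTE ji) SE eq_sym (negbTE ji).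
  by ring.
have cN : 0 < c * N by rewrite mulr_gt0.
apply: le_trans (_ : \sum_i (c * N) ^- 2 * (3 * ((\sum_j x i j * u j) ^+ 2 +
    (\sum_(j | j != i) m * u j) ^+ 2 + (\sum_j z i j * u j) ^+ 2)) <= _).
  apply: ler_sum => i _; rewrite rowE exprMn ler_pM ?sqr_ge0//.
    have r0 : 0 < \sum_k `|S i k| by rewrite (lt_le_trans cN).
    rewrite -exprVn ler_pXn2r// ?nnegrE ?invr_ge0 ?(ltW r0) ?(ltW cN)//.
    by rewrite lef_pV2 ?posrE.
  move: (\sum_j x i j * u j) (\sum_(j | j != i) m * u j) (\sum_j z i j * u j).
  move=> a b d; have := sqr_ge0 (a - b); have := sqr_ge0 (a - d).
  by have := sqr_ge0 (b - d); nra.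
rewrite -mulr_sumr -mulr_sumr !big_split/=.
rewrite (_ : 9 * eta / c ^+ 2 * U = (c * N) ^- 2 * (3 * (eta * N ^+ 2 * U +
  eta * N ^+ 2 * U + eta * N ^+ 2 * U))); last first.
  by field; rewrite !gt_eqF.
rewrite ler_wpM2l//; first by rewrite invr_ge0 sqr_ge0.
by rewrite ler_wpM2l// !lerD.
Qed.

(** * Law of a single entry *)

Section strength_law.
Context (d : measure_display) (T : measurableType d) (R : realType)
  (P : probability T R).
Context (dZ : measure_display) (TZ : measurableType dZ)
  (PZ : probability TZ R) (Z : {RV PZ >-> R}).
Variables (p : R) (b : {RV P >-> bool}) (r : {RV P >-> R}).
Hypothesis b_law : P (b @^-1` [set true]) = p%:E.
Hypothesis r_law : forall C : set R, measurable C ->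
  distribution P r C = distribution PZ Z C.

(** The entry is either the strength or [0], so the comparison is pointwise. It is meant for squared
    tails, which may be unbounded; hence the integrals in the extended reals. *)
Lemma integral_gated_le (g : R -> R) : measurable_fun [set: R] g ->
  (forall x, 0 <= g x) -> g 0 = 0 ->
  (\int[P]_w (g (gated b r w))%:E <= \int[PZ]_w (g (Z w))%:E)%E.
Proof.
move=> mg g0 g00.
have mg' : measurable_fun [set: R] (EFin \o g) by exact/measurable_EFinP.
have -> : (\int[PZ]_w (g (Z w))%:E = \int[P]_w (g (r w))%:E)%E.
  rewrite -(ge0_integral_distribution Z mg')//.
  rewrite -(ge0_integral_distribution r mg')//.
  by apply: eq_measure_integral => C mC _; exact/esym/r_law.
apply: ge0_le_integral => //.
- by move=> w _; rewrite lee_fin.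
- apply/measurable_EFinP; apply: measurableT_comp => //; exact: measurable_gated.
- by apply/measurable_EFinP; apply: measurableT_comp.
- by move=> w _; rewrite lee_fin /gated; case: ifP => // _; rewrite g00.
Qed.

Hypothesis br_indep : forall A C, measurable C ->
  P (b @^-1` A `&` r @^-1` C) = (P (b @^-1` A) * P (r @^-1` C))%E.

Lemma mean_gated (F : R -> R) : bounded_mfun F ->
  (\int[P]_w F (gated b r w) = (1 - p) * F 0 + p * \int[PZ]_w F (Z w))%R.
Proof.
move=> bF; apply/eqP; rewrite -subr_eq0; apply/eqP.
have p0 : 0 <= p by rewrite -lee_fin -b_law.
have p1 : p <= 1 by rewrite -lee_fin -b_law probability_le1//; exact: measurable_funPTI.
pose Phi (F : R -> R) := (\int[P]_w F (gated b r w) -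
  ((1 - p) * F 0 + p * \int[PZ]_w F (Z w)))%R.
have bg (f : R -> R) : bounded_mfun f -> bounded_mfun (fun w => f (gated b r w)).
  by move=> bf; apply: (bounded_mfun_comp bf); exact: measurable_gated.
have bZ (f : R -> R) : bounded_mfun f -> bounded_mfun (fun w => f (Z w)).
  by move=> bf; apply: (bounded_mfun_comp bf); exact: measurable_funPT.
(* The constant is [1 + (1 - p) + p], one summand for each value or mean in [Phi]. *)
apply: (@functional_eq0_of_indic _ _ _ Phi 2) => //.
- move=> f g bf bg_; rewrite /Phi (meanD P (bg _ bf) (bg _ bg_)).
  by rewrite (meanD PZ (bZ _ bf) (bZ _ bg_)); ring.
- by move=> a f bf; rewrite /Phi (meanZ P a (bg _ bf)) (meanZ PZ a (bZ _ bf)); ring.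
- move=> f M bf fM; have M0 : 0 <= M by rewrite (le_trans _ (fM 0)).
  have h1 := mean_norm_le P (bg _ bf) (fun w => fM (gated b r w)).
  have h2 := mean_norm_le PZ (bZ _ bf) (fun w => fM (Z w)).
  have h3 := fM 0.
  move: h1 h2 h3; rewrite /Phi !ler_norml; move: (\int[P]_w _)%R (\int[PZ]_w _)%R (f 0).
  by move=> x y z /andP[? ?] /andP[? ?] /andP[? ?]; nra.
move=> C mC; rewrite /Phi.
have mb A : measurable (b @^-1` A) by exact: measurable_funPTI.
have mr : measurable (r @^-1` C) by exact: measurable_funPTI.
have mZ : measurable (Z @^-1` C) by exact: measurable_funPTI.
have b_false : P (b @^-1` [set false]) = (1 - p)%:E.
  rewrite (_ : _ @^-1` _ = ~` (b @^-1` [set true])).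
    by rewrite probability_setC// b_law.
  by apply/seteqP; split => w /=; case: (b w).
have E w : \1_C (gated b r w) = \1_(b @^-1` [set true] `&` r @^-1` C) w +
    \1_C 0 * \1_(b @^-1` [set false]) w :> R.
  have bE x : \1_(b @^-1` [set x]) w = (b w == x)%:R :> R.
    by rewrite indicE; congr (_%:R); apply: congr1; apply/idP/eqP; rewrite inE.
  rewrite indicI /= !bE /gated; case: (b w) => /=.
    by rewrite mul1r mulr0 addr0.
  by rewrite mul0r add0r mulr1.
under eq_Rintegral do rewrite E.
have -> : (\int[PZ]_w (\1_C (Z w)) = fine (PZ (Z @^-1` C)))%R.
  by rewrite -mean_indic//; apply: eq_Rintegral => w _; rewrite !indicE.
rewrite meanD; first last.
- by apply: bounded_mfunZ; exact: bounded_mfun_indic.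
- by apply: bounded_mfun_indic; exact: measurableI.
rewrite meanZ; last exact: bounded_mfun_indic.
rewrite !mean_indic//; last exact: measurableI.
rewrite br_indep// b_law b_false.
have -> : P (r @^-1` C) = PZ (Z @^-1` C) by exact: (r_law mC).
rewrite fineM//=; last exact: fin_num_measure.
by ring.
Qed.

End strength_law.

(** * Truncation and moments of the strength *)

Definition clip (R : realType) (B x : R) : R := if `|x| <= B then x else 0.

Definition clip_tail (R : realType) (B x : R) : R := x - clip B x.

Lemma clip_tailE (R : realType) (B x : R) :
  clip_tail B x = if `|x| <= B then 0 else x.
Proof. by rewrite /clip_tail /clip; case: ifP => _; rewrite ?subrr ?subr0. Qed.

(** Large values are sent to [0] rather than to the nearest bound, so the two pieces are never both
    nonzero and there is no cross term. *)
Lemma sqr_clip (R : realType) (B x : R) :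
  x ^+ 2 = clip B x ^+ 2 + clip_tail B x ^+ 2.
Proof. by rewrite clip_tailE /clip; case: ifP => _; rewrite expr0n ?addr0 ?add0r. Qed.

Lemma normr_clip_le (R : realType) (B x : R) : 0 <= B -> `|clip B x| <= B.
Proof. by rewrite /clip; case: ifP => // _; rewrite normr0. Qed.

Lemma normr_clip_tail_le (R : realType) (B x : R) : 1 <= B ->
  `|clip_tail B x| <= clip_tail B x ^+ 2.
Proof.
move=> B1; rewrite clip_tailE; case: ifPn; first by rewrite normr0 expr0n.
rewrite -ltNge => Bx; rewrite -real_normK ?num_real// expr2.
by rewrite ler_peMl// ltW// (le_lt_trans B1).
Qed.

Lemma measurable_clip (R : realType) (B : R) : measurable_fun [set: R] (clip B).
Proof.
apply: measurable_fun_ifT => //.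
by apply: measurable_fun_ler; [exact: normr_measurable|exact: measurable_cst].
Qed.

Lemma measurable_clip_tail (R : realType) (B : R) :
  measurable_fun [set: R] (clip_tail B).
Proof. by apply: measurable_funB => //; exact: measurable_clip. Qed.

Lemma bounded_mfun_clip (R : realType) (B : R) : 0 <= B -> bounded_mfun (clip B).
Proof.
by move=> B0; split; [exact: measurable_clip|exists B => x; exact: normr_clip_le].
Qed.

Lemma bounded_mfun_expN (R : realType) : bounded_mfun (fun x : R => expR (- `|x|)).
Proof.
split; last first.
  by exists 1 => x; rewrite ger0_norm ?expR_ge0// -expR0 ler_expR oppr_le0.
do 2 (apply: measurableT_comp => //).
Qed.

Section centered_strength.
Context (dZ : measure_display) (TZ : measurableType dZ) (R : realType)
  (PZ : probability TZ R) (Z : {RV PZ >-> R}) (sigma : R).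
Hypothesis Z_mean : ('E_PZ[Z] = 0)%E.
Hypothesis Z_var : 'V_PZ[Z] = (sigma ^+ 2)%:E.
Hypothesis sigma_gt0 : 0 < sigma.

Lemma second_moment : (\int[PZ]_w (Z w ^+ 2)%:E = (sigma ^+ 2)%:E)%E.
Proof.
rewrite -Z_var /variance covariance.unlock expectation.unlock.
have -> : fine (\int[PZ]_w (Z w)%:E)%E = 0.
  by have := Z_mean; rewrite expectation.unlock => ->.
apply: eq_integral => w _.
by rewrite -[RHS]/(((Z w - 0) * (Z w - 0))%:E) subr0 expr2.
Qed.

Lemma integrable_sqr : PZ.-integrable [set: TZ] (EFin \o (fun w => Z w ^+ 2)).
Proof.
apply/integrableP; split.
  by apply/measurable_EFinP; apply: measurable_funX.
under eq_integral do rewrite /= ger0_norm ?sqr_ge0//.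
by rewrite second_moment ltry.
Qed.

Lemma integrable_strength : PZ.-integrable [set: TZ] (EFin \o Z).
Proof.
have i1 : PZ.-integrable [set: TZ] (EFin \o (fun w => 1 + Z w ^+ 2)).
  have := integrableD measurableT
    (bounded_mfun_integrable PZ (bounded_mfun_cst TZ (1 : R))) integrable_sqr.
  by [].
apply: le_integrable i1 => //.
  by apply/measurable_EFinP.
move=> w _ /=; rewrite lee_fin [leRHS]ger0_norm ?addr_ge0 ?sqr_ge0//.
rewrite -[X in _ + X]real_normK ?num_real//.
by have := sqr_ge0 (`|Z w| - 1); have := normr_ge0 (Z w); nra.
Qed.

Lemma integrable_sqr_tail (B : R) :
  PZ.-integrable [set: TZ] (EFin \o (fun w => clip_tail B (Z w) ^+ 2)).
Proof.
apply: le_integrable integrable_sqr => //.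
  apply/measurable_EFinP; apply: measurable_funX; apply: measurableT_comp => //.
  exact: measurable_clip_tail.
move=> w _ /=; rewrite lee_fin !ger0_norm ?sqr_ge0//.
by rewrite [leRHS](sqr_clip B) lerDr sqr_ge0.
Qed.

(** Dominated convergence: at each point the squared tails are eventually zero, and [Z^2] dominates
    them. *)
Lemma tail_second_moment (e : R) : 0 < e ->
  exists2 B, 1 <= B & (\int[PZ]_w (clip_tail B (Z w) ^+ 2) <= e)%R.
Proof.
move=> e0.
have mt n : measurable_fun [set: TZ] (fun w => (clip_tail n.+1%:R (Z w) ^+ 2)%:E).
  by have /measurable_int := integrable_sqr_tail n.+1%:R.
have f_f : {ae PZ, forall w, [set: TZ] w ->
    (fun n => (clip_tail n.+1%:R (Z w) ^+ 2)%:E) @ \oo --> (0%E : \bar R)}.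
  apply: aeW => w _; apply: cvg_near_cst.
  exists (Num.truncn `|Z w|) => // n /= wn.
  rewrite clip_tailE ifT ?expr0n// ltW// (lt_le_trans (truncnS_gt _))//.
  by rewrite ler_nat.
have f_g : {ae PZ, forall w n, [set: TZ] w ->
    (`|(clip_tail n.+1%:R (Z w) ^+ 2)%:E| <= (Z w ^+ 2)%:E)%E}.
  apply: aeW => w n _; rewrite /= lee_fin ger0_norm ?sqr_ge0//.
  by rewrite [leRHS](sqr_clip n.+1%:R) lerDr sqr_ge0.
have [_ _] := dominated_convergence measurableT mt (measurable_cst 0%E) f_f
  integrable_sqr f_g.
rewrite integral0 => /fine_cvgP[_ /cvgrPdist_le/(_ _ e0)[n _ /(_ n (leqnn n))]].
rewrite sub0r normrN => hn; exists n.+1%:R; first by rewrite ler1n.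
exact: le_trans (ler_norm _) hn.
Qed.

(** Since [Z] is centered, the clipped part and the tail have opposite means; for [B >= 1] the tail
    is dominated by its square. *)
Lemma mean_clip_le (B e : R) : 1 <= B ->
  (\int[PZ]_w (clip_tail B (Z w) ^+ 2) <= e)%R ->
  `|\int[PZ]_w clip B (Z w)|%R <= e.
Proof.
move=> B1 Be.
have it : PZ.-integrable [set: TZ] (EFin \o (fun w => clip_tail B (Z w))).
  apply: le_integrable integrable_strength => //.
    apply/measurable_EFinP; apply: measurableT_comp => //.
    exact: measurable_clip_tail.
  move=> w _ /=; rewrite lee_fin clip_tailE; case: ifP => // _.
  by rewrite normr0.
have -> : (\int[PZ]_w clip B (Z w) = - \int[PZ]_w clip_tail B (Z w))%R.
  transitivity (\int[PZ]_w (Z w - clip_tail B (Z w)))%R.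
    by apply: eq_Rintegral => w _; rewrite /clip_tail subKr.
  rewrite RintegralB//; last exact: integrable_strength.
  suff -> : (\int[PZ]_w Z w = 0)%R by rewrite sub0r.
  by rewrite /Rintegral; have := Z_mean; rewrite expectation.unlock => ->.
rewrite normrN (le_trans (le_normr_Rintegral _ _))//.
apply: le_trans Be; apply: le_Rintegral => //.
- exact: integrable_norm it.
- exact: integrable_sqr_tail.
- by move=> w _; exact: normr_clip_tail_le.
Qed.

(** Makes the Chernoff bound on row sums nontrivial. Positive variance keeps a clipped second moment
    of at least [sigma^2 / 2], and [exp(- |u|)] lies below [1 - k u^2] on the clipping range. *)
Lemma mean_expN_lt1 : (\int[PZ]_w expR (- `|Z w|) < 1)%R.
Proof.
have s2 : 0 < sigma ^+ 2 / 2 by rewrite divr_gt0// exprn_gt0.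
have [B B1 hB] := tail_second_moment s2.
have B0 : 0 < B by rewrite (lt_le_trans _ B1).
(* For [u >= 0], [1 / (1 + u) <= 1 - k u^2] follows from [k u (1 + u) <= 1], which this [k] grants
   up to [u = B]. *)
pose k := (B * (1 + B))^-1.
have k0 : 0 < k by rewrite invr_gt0 mulr_gt0// addr_gt0.
have bc : bounded_mfun (fun w => clip B (Z w) ^+ 2).
  have := bounded_mfun_clip (ltW B0) => bc0.
  under eq_fun do rewrite expr2.
  by apply: bounded_mfunM; apply: (bounded_mfun_comp bc0); exact: measurable_funPT.
have c2 : sigma ^+ 2 / 2 <= (\int[PZ]_w (clip B (Z w) ^+ 2))%R.
  have : (\int[PZ]_w (Z w ^+ 2) = sigma ^+ 2)%R by rewrite /Rintegral second_moment.
  under eq_Rintegral do rewrite (sqr_clip B).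
  rewrite RintegralD//; [|exact: bounded_mfun_integrable|exact: integrable_sqr_tail].
  by lra.
apply: (@le_lt_trans _ _ (\int[PZ]_w (1 - k * clip B (Z w) ^+ 2))%R).
  apply: mean_le.
  - by apply: (bounded_mfun_comp (bounded_mfun_expN R)); exact: measurable_funPT.
  - by apply: bounded_mfunB; [exact: bounded_mfun_cst|exact: bounded_mfunZ].
  move=> w; rewrite /clip; case: ifPn => zB; last first.
    by rewrite expr0n mulr0 subr0 -expR0 ler_expR oppr_le0.
  rewrite -[_ ^+ 2]real_normK ?num_real//; move: `|Z w| (normr_ge0 (Z w)) zB => u u0 uB.
  rewrite expRN.
  have u1 : 0 < 1 + u by rewrite ltr_wpDr.
  apply: (@le_trans _ _ (1 + u)^-1).
    by rewrite lef_pV2 ?posrE ?expR_gt0//; exact: expR_ge1Dx.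
  rewrite -[leLHS]mul1r ler_pdivrMr//.
  have kE : k * (B * (1 + B)) = 1 by rewrite mulVf// gt_eqF// mulr_gt0// addr_gt0.
  suff : k * u * (1 + u) <= 1 by nra.
  rewrite -kE -mulrA ler_wpM2l ?(ltW k0)//.
  nra.
rewrite meanB; [|exact: bounded_mfun_cst|exact: bounded_mfunZ].
by rewrite mean_cst meanZ// gtrBl mulr_gt0// (lt_le_trans s2).
Qed.

End centered_strength.

(** Markov's inequality for [Y1 + Y2]. [Y1] will carry the possibly unbounded tails, so its mean is
    bounded in the extended reals. *)
Lemma markov_lt1 (d : measure_display) (T : measurableType d) (R : realType)
    (P : probability T R) (Y1 Y2 : T -> R) (a : R) :
  measurable_fun [set: T] Y1 -> (forall w, 0 <= Y1 w) ->
  (\int[P]_w (Y1 w)%:E <= a%:E)%E ->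
  bounded_mfun Y2 -> (forall w, 0 <= Y2 w) ->
  measurable [set w | Y1 w + Y2 w < 1] /\
  ((1 - (a + \int[P]_w Y2 w)%R)%:E <= P [set w | (Y1 w + Y2 w < 1)%R])%E.
Proof.
move=> mY1 Y10 Y1a bY2 Y20.
have mY : measurable_fun [set: T] (fun w => Y1 w + Y2 w).
  by apply: measurable_funD => //; exact: bY2.1.
have mE : measurable [set w | Y1 w + Y2 w < 1].
  rewrite (_ : [set _ | _] = (fun w => Y1 w + Y2 w) @^-1` `]-oo, 1[); last first.
    by apply/seteqP; split => w /=; rewrite in_itv.
  by rewrite -[X in measurable X]setTI; exact: mY.
split => //.
have Y0 w : 0 <= Y1 w + Y2 w by rewrite addr_ge0.
have : (P (~` [set w | (Y1 w + Y2 w < 1)%R]) <= (a + \int[P]_w Y2 w)%R%:E)%E.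
  have mY' : measurable_fun [set: T] (EFin \o (fun w => Y1 w + Y2 w)).
    exact/measurable_EFinP.
  have := le_integral_abse P measurableT mY' (@ltr01 R).
  rewrite setTI mul1e => h; apply: le_trans (le_trans _ h) _.
    rewrite (_ : ~` _ = [set x | (1%:E <= `|(EFin \o (fun w => (Y1 w + Y2 w)%R)) x|)%E])//.
    apply/seteqP; split => w /=.
      by move/negP; rewrite -leNgt lee_fin ger0_norm.
    by rewrite lee_fin ger0_norm// => h1; apply/negP; rewrite -leNgt.
  under eq_integral do rewrite /= ger0_norm// EFinD.
  rewrite ge0_integralD//; first last.
  - by apply/measurable_EFinP; exact: bY2.1.
  - by move=> w _; rewrite lee_fin.
  - exact/measurable_EFinP.
  - by move=> w _; rewrite lee_fin.
  rewrite EFinD leeD// /Rintegral fineK//.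
  by apply: integrable_fin_num => //; exact: bounded_mfun_integrable.
rewrite probability_setC//.
have : P [set w | Y1 w + Y2 w < 1] \is a fin_num by exact: fin_num_measure.
by case: (P _) => // x _; rewrite /= !lee_fin; lra.
Qed.

(** * The event of small coupling for a fixed [n] *)

Section coupling_event.
Context (R : realType) (dZ : measure_display) (TZ : measurableType dZ)
  (PZ : probability TZ R) (Z : {RV PZ >-> R}) (p : R).
Context (d : measure_display) (T : measurableType d) (P : probability T R)
  (n : nat).
Variables (sel : 'I_n -> 'I_n -> {RV P >-> bool})
  (str : 'I_n -> 'I_n -> {RV P >-> R}).
Hypothesis model : random_mixed_interactions Z p sel str.
Hypothesis p_le1 : p <= 1.
Hypothesis p_ge0 : 0 <= p.

Let b (k : 'I_n * 'I_n) := sel k.1 k.2.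
Let r (k : 'I_n * 'I_n) := str k.1 k.2.
Let D (k : 'I_n * 'I_n) := k.1 != k.2.
Let s i j w := gated (sel i j) (str i j) w.

Let indep (A : 'I_n * 'I_n -> set bool) (C : 'I_n * 'I_n -> set R) :
  (forall k, measurable (A k)) -> (forall k, measurable (C k)) ->
  P (\bigcap_(k in [set k | D k]) (b k @^-1` A k `&` r k @^-1` C k)) =
  (\prod_(k | D k) (P (b k @^-1` A k) * P (r k @^-1` C k)))%E.
Proof.
move=> mA mC; have [_ _ h] := model.
have := h (fun i j => A (i, j)) (fun i j => C (i, j)) (fun i j => mA _) (fun i j => mC _).
have -> : (fun k : 'I_n * 'I_n => sel k.1 k.2 @^-1` A (k.1, k.2) `&` str k.1 k.2 @^-1` C (k.1, k.2))
    = (fun k => b k @^-1` A k `&` r k @^-1` C k) by apply/funext => -[].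
by move=> ->; apply: eq_bigr => -[].
Qed.

Lemma mean_entry (i j : 'I_n) (F : R -> R) : i != j -> bounded_mfun F ->
  (\int[P]_w F (s i j w) = (1 - p) * F 0 + p * \int[PZ]_w F (Z w))%R.
Proof.
move=> ij bF; have [h1 h2 _] := model; apply: mean_gated => //.
- exact: h1.
- exact: h2.
- by move=> A C mC; exact: (prob_cell (k := (i, j)) indep).
Qed.

Lemma mean_prod_entries (F : 'I_n * 'I_n -> R -> R) :
  (forall k, bounded_mfun (F k)) ->
  (\int[P]_w (\prod_(k | k.1 != k.2) F k (s k.1 k.2 w)) =
   \prod_(k | k.1 != k.2) \int[P]_w F k (s k.1 k.2 w))%R.
Proof. move=> bF; exact: (@mean_prod_gated _ _ _ P _ D b r indep F bF). Qed.

Let measurable_s i j : measurable_fun [set: T] (s i j).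
Proof. exact: measurable_gated. Qed.

Let bounded_s (F : R -> R) i j : bounded_mfun F -> bounded_mfun (fun w => F (s i j w)).
Proof. by move=> bF; apply: (bounded_mfun_comp bF); exact: measurable_s. Qed.

Lemma strength_matrixE (i j : 'I_n) w :
  strength_matrix (fun i j => sel i j w) (fun i j => str i j w) i j =
  if i == j then 0 else s i j w.
Proof. by rewrite mxE /s /gated; case: eqVneq. Qed.

Section truncation.
Variables (B eta c : R).
Hypothesis B_ge0 : 0 <= B.

(** The common mean of the clipped off-diagonal entries, as [clip] vanishes at [0]; subtracting it
    centers [x]. *)
Let m := p * (\int[PZ]_w clip B (Z w))%R.
Let x i j w := if i == j then 0 else clip B (s i j w) - m.
Let z i j w := if i == j then 0 else clip_tail B (s i j w).
Let row i w := \sum_(j | i != j) `|s i j w|.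

Let m_le : `|m| <= B.
Proof.
rewrite /m normrM (ger0_norm p_ge0) -[leRHS]mul1r ler_pM//.
apply: mean_norm_le; last by move=> w; exact: normr_clip_le.
by apply: (bounded_mfun_comp (bounded_mfun_clip B_ge0)); exact: measurable_funPT.
Qed.

Let bounded_centered : bounded_mfun (fun v : R => clip B v - m).
Proof.
by apply: bounded_mfunB; [exact: bounded_mfun_clip|exact: bounded_mfun_cst].
Qed.

Let bx i j : bounded_mfun (x i j).
Proof.
rewrite /x; case: eqP => _; first exact: (bounded_mfun_cst _ 0).
exact: (bounded_s i j bounded_centered).
Qed.

Let x_le i j w : `|x i j w| <= 2 * B.
Proof.
rewrite /x; case: eqP => _; first by rewrite normr0 mulr_ge0.
rewrite (le_trans (ler_normB _ _))// mulr_natl mulr2n lerD//.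
exact: normr_clip_le.
Qed.

Let mean_centered i j : i != j -> (\int[P]_w (clip B (s i j w) - m) = 0)%R.
Proof.
move=> ij; rewrite (mean_entry ij bounded_centered).
rewrite [X in _ + _ * X]meanB; last 2 first.
- by apply: (bounded_mfun_comp (bounded_mfun_clip B_ge0)); exact: measurable_funPT.
- exact: bounded_mfun_cst.
rewrite mean_cst /clip normr0 B_ge0 -/(clip B _) /m.
by rewrite -[X in p * (X - _)]/(\int[PZ]_w clip B (Z w))%R; ring.
Qed.

(** With distinct rows and distinct columns the four positions are pairwise distinct, so the mean
    factors into centered means. If one position is diagonal, the product is zero pointwise. *)
Let mean_four i j k l : i != k -> j != l ->
  (\int[P]_w (x i j w * x i l w * (x k j w * x k l w)) = 0)%R.
Proof.
move=> ik jl.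
have [->|ij] := eqVneq i j.
  by under eq_Rintegral do rewrite /x eqxx !mul0r; rewrite mean_cst.
have [->|il] := eqVneq i l.
  by under eq_Rintegral do rewrite /x eqxx mulr0 mul0r; rewrite mean_cst.
have [->|kj] := eqVneq k j.
  by under eq_Rintegral do rewrite /x eqxx mul0r mulr0; rewrite mean_cst.
have [->|kl] := eqVneq k l.
  by under eq_Rintegral do rewrite /x eqxx !mulr0; rewrite mean_cst.
pose q := [:: (i, j); (i, l); (k, j); (k, l)].
have uq : uniq q.
  by rewrite /q /= !inE !xpair_eqE !eqxx (negbTE ik) (negbTE jl).
have Dq a : a \in q -> a.1 != a.2.
  by rewrite !inE => /or4P[] /eqP ->.
pose F a (v : R) := if a \in q then clip B v - m else 1.
have bF a : bounded_mfun (F a).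
  by rewrite /F; case: (a \in q) => //; exact: (bounded_mfun_cst _ 1).
transitivity (\int[P]_w (\prod_(a | a.1 != a.2) F a (s a.1 a.2 w)))%R.
  apply: eq_Rintegral => w _.
  rewrite /F -big_mkcondr (eq_bigl (fun a => a \in q)); last first.
    by move=> a; apply/andP/idP => [[]//|aq]; split => //; exact: Dq.
  rewrite -(big_uniq _ uq) /q !big_cons big_nil /= mulr1 mulrA /x.
  by rewrite (negbTE ij) (negbTE il) (negbTE kj) (negbTE kl) !mulrA.
rewrite mean_prod_entries// (bigD1 (i, j))//= /F mem_head.
by rewrite mean_centered// mul0r.
Qed.

(** After expansion only the terms with [i = k] or [j = l] survive: at most [2 n^3] of them, each
    bounded by [(2 B)^4]. *)
Lemma mean_gram :
  (\int[P]_w (\sum_j \sum_l (\sum_i x i j w * x i l w) ^+ 2) <=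
   32 * B ^+ 4 * n%:R ^+ 3)%R.
Proof.
have B4 : 0 <= (2 * B) ^+ 4 by rewrite exprn_ge0// mulr_ge0.
have b4 i k j l : bounded_mfun (fun w => x i j w * x i l w * (x k j w * x k l w)).
  by apply: bounded_mfunM; apply: bounded_mfunM.
have E w : \sum_j \sum_l (\sum_i x i j w * x i l w) ^+ 2 =
    \sum_j \sum_l \sum_i \sum_k x i j w * x i l w * (x k j w * x k l w).
  by apply: eq_bigr => j _; apply: eq_bigr => l _; rewrite expr2 big_distrlr.
under eq_Rintegral do rewrite E.
rewrite mean_sum; last first.
  by move=> j _; do 3 (apply: bounded_mfun_sum => ? _); exact: b4.
apply: (@le_trans _ _ (\sum_(j < n) \sum_(l < n) \sum_(i < n) \sum_(k < n)
   (2 * B) ^+ 4 * ((i == k)%:R + (j == l)%:R))).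
  apply: ler_sum => j _; rewrite mean_sum; last first.
    by move=> l _; do 2 (apply: bounded_mfun_sum => ? _); exact: b4.
  apply: ler_sum => l _; rewrite mean_sum; last first.
    by move=> i _; apply: bounded_mfun_sum => ? _; exact: b4.
  apply: ler_sum => i _; rewrite mean_sum; last by move=> k _; exact: b4.
  apply: ler_sum => k _.
  have bound : (\int[P]_w (x i j w * x i l w * (x k j w * x k l w)) <= (2 * B) ^+ 4)%R.
    rewrite (le_trans (ler_norm _))//; apply: mean_norm_le => // w.
    rewrite !normrM (_ : (2 * B) ^+ 4 = (2 * B) * (2 * B) * ((2 * B) * (2 * B))); last by ring.
    by rewrite !ler_pM// mulr_ge0.
  have [ik|ik] := eqVneq i k; first by rewrite (le_trans bound)// ler_peMr// lerDl.
  have [jl|jl] := eqVneq j l; first by rewrite (le_trans bound)// ler_peMr// lerDr.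
  by rewrite mean_four// addr0 mulr0.
have delta (a : 'I_n) : \sum_(k < n) ((a == k)%:R : R) = 1.
  by rewrite (bigD1 a)//= eqxx big1 ?addr0// => k /negbTE; rewrite eq_sym => ->.
have E2 (j l : 'I_n) : \sum_(i < n) \sum_(k < n) (2 * B) ^+ 4 * ((i == k)%:R + (j == l)%:R) =
    (2 * B) ^+ 4 * (n%:R + n%:R ^+ 2 * (j == l)%:R).
  under eq_bigr do rewrite -mulr_sumr big_split/= delta sumr_const card_ord.
  by rewrite sumr_const card_ord -[RHS]mulr1 -mulr_natr -[_ *+ n]mulr_natr; ring.
have E1 (j : 'I_n) : \sum_(l < n) (2 * B) ^+ 4 * (n%:R + n%:R ^+ 2 * (j == l)%:R) =
    (2 * B) ^+ 4 * (2 * n%:R ^+ 2).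
  rewrite -mulr_sumr big_split/= -mulr_sumr delta sumr_const card_ord.
  by rewrite -[_ *+ n]mulr_natr; ring.
under eq_bigr do under eq_bigr do rewrite E2.
under eq_bigr do rewrite E1.
rewrite sumr_const card_ord -[_ *+ n]mulr_natr le_eqVlt; apply/orP; left; apply/eqP.
by ring.
Qed.

Let q := (1 - p) + p * (\int[PZ]_w expR (- `|Z w|))%R.

Let bounded_exp_row i : bounded_mfun (fun w => expR (- row i w)).
Proof.
split; last first.
  exists 1 => w; rewrite ger0_norm ?expR_ge0// -expR0 ler_expR oppr_le0.
  by apply: sumr_ge0 => j _.
do 2 apply: measurableT_comp => //.
rewrite /row; under eq_fun do rewrite big_mkcond/=.
apply: measurable_sum => j; case: (i != j); last exact: measurable_cst.
by apply: measurableT_comp => //; exact: measurable_s.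
Qed.

(** The exponential of the row sum factors over the [n.-1] off-diagonal entries of row [i]; the
    other rows contribute factors [1]. *)
Lemma mean_exp_row i : (\int[P]_w expR (- row i w) = q ^+ n.-1)%R.
Proof.
pose F (a : 'I_n * 'I_n) (v : R) := if a.1 == i then expR (- `|v|) else 1.
have bF a : bounded_mfun (F a).
  rewrite /F; case: (a.1 == i); first exact: bounded_mfun_expN.
  exact: (bounded_mfun_cst _ 1).
have prodE (G : 'I_n * 'I_n -> R) : (forall a, a.1 != i -> G a = 1) ->
    \prod_(a | a.1 != a.2) G a = \prod_(j | i != j) G (i, j).
  move=> G1; rewrite (eq_bigr (fun a => G (a.1, a.2))); last by case.
  rewrite -(pair_big_dep xpredT (fun i j => i != j) (fun i j => G (i, j)))/=.
  rewrite (bigD1 i)//= [X in _ * X]big1 ?mulr1// => k ki.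
  by rewrite big1// => j _; rewrite G1.
transitivity (\int[P]_w (\prod_(a | a.1 != a.2) F a (s a.1 a.2 w)))%R.
  apply: eq_Rintegral => w _; rewrite prodE; last by move=> a /negbTE; rewrite /F => ->.
  rewrite /row -sumrN expR_sum; apply: eq_bigr => j _; by rewrite /F eqxx.
rewrite mean_prod_entries// prodE; last first.
  by move=> a /negbTE ai; rewrite /F ai mean_cst.
rewrite (eq_bigr (fun=> q)); last first.
  move=> j ij; rewrite /F/= eqxx (mean_entry ij (bounded_mfun_expN R)).
  by rewrite normr0 oppr0 expR0 mulr1.
rewrite prodr_const; congr (_ ^+ _).
rewrite (eq_card (B := predC1 i)); last by move=> j; rewrite !inE eq_sym.
by rewrite cardC1 card_ord.
Qed.

(** The three error terms come in order from the tails, the Gram matrix of the centered part, and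
    the Chernoff bound summed over the [n] rows. *)
Lemma coupling_event (kappa : R) : (0 < n)%N -> 0 < eta -> 0 < c ->
  (\int[PZ]_w (clip_tail B (Z w) ^+ 2)%:E <= kappa%:E)%E -> m ^+ 2 <= eta ->
  exists A : set T, [/\ measurable A,
    ((1 - (kappa / eta + (32 * B ^+ 4 / (eta ^+ 2 * n%:R) +
       n%:R * expR (c * n%:R) * q ^+ n.-1)))%:E <= P A)%E &
    forall w, A w -> forall u : 'I_n -> R,
      \sum_i (\sum_j random_interaction_matrix sel str w i j * u j) ^+ 2 <=
      9 * eta / c ^+ 2 * \sum_j u j ^+ 2].
Proof.
move=> n0 eta0 c0 tail_le m_le_eta.
have N0 : 0 < (n%:R : R) by rewrite ltr0n.
pose N : R := n%:R; pose h := (eta * N ^+ 2)^-1.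
have h0 : 0 < h by rewrite invr_gt0 mulr_gt0// exprn_gt0.
(* Outside [Y1 + Y2 < 1] one of the three defects (tails, Gram matrix, row sums)
   is large; summing them lets one Markov bound replace a union bound. *)
pose Y1 w := h * \sum_i \sum_j z i j w ^+ 2.
pose Y2 w := h ^+ 2 * (\sum_j \sum_l (\sum_i x i j w * x i l w) ^+ 2) +
  expR (c * N) * \sum_i expR (- row i w).
have z0 w : 0 <= \sum_i \sum_j z i j w ^+ 2.
  by do 2 (apply: sumr_ge0 => ? _); exact: sqr_ge0.
have x0 w : 0 <= \sum_j \sum_l (\sum_i x i j w * x i l w) ^+ 2.
  by do 2 (apply: sumr_ge0 => ? _); exact: sqr_ge0.
have e0 w : 0 <= \sum_i expR (- row i w).
  by apply: sumr_ge0 => i _; exact: expR_ge0.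
have Y10 w : 0 <= Y1 w by apply: mulr_ge0 => //; exact: ltW.
have Y20 w : 0 <= Y2 w.
  by apply: addr_ge0; apply: mulr_ge0; rewrite ?expR_ge0 ?sqr_ge0.
have mz i j : measurable_fun [set: T] (fun w => z i j w ^+ 2).
  apply: measurable_funX; rewrite /z; case: eqP => _; first exact: measurable_cst.
  by apply: measurableT_comp; [exact: measurable_clip_tail|exact: measurable_s].
have mzs : measurable_fun [set: T] (fun w => \sum_i \sum_j z i j w ^+ 2).
  by apply: measurable_sum => i; apply: measurable_sum.
have mY1 : measurable_fun [set: T] Y1.
  by apply: measurable_funM => //; exact: measurable_cst.
have Y1_le : (\int[P]_w (Y1 w)%:E <= (kappa / eta)%:E)%E.
  have z_le i j : (\int[P]_w (z i j w ^+ 2)%:E <= kappa%:E)%E.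
    apply: le_trans tail_le; rewrite /z; case: (eqVneq i j) => [_|ij].
      rewrite expr0n/= integral0; apply: integral_ge0 => w _.
      by rewrite lee_fin sqr_ge0.
    have [_ str_law _] := model.
    apply: (@integral_gated_le _ _ _ P _ _ PZ Z (sel i j) (str i j)
      (str_law i j ij) (fun v => clip_tail B v ^+ 2)).
    - by apply: measurable_funX; exact: measurable_clip_tail.
    - by move=> v; exact: sqr_ge0.
    - by rewrite clip_tailE if_same expr0n.
  rewrite /Y1; under eq_integral do rewrite EFinM.
  rewrite ge0_integralZl//=; [|exact/measurable_EFinP|
    by move=> w _; rewrite lee_fin|by rewrite lee_fin ltW].
  have : (\int[P]_w (\sum_i \sum_j z i j w ^+ 2)%:E <= (N ^+ 2 * kappa)%:E)%E.
    under eq_integral do rewrite -sumEFin.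
    rewrite ge0_integral_sum//; last 2 first.
    - by move=> i; apply/measurable_EFinP; exact: measurable_sum.
    - by move=> i w _; rewrite lee_fin sumr_ge0// => ? _; exact: sqr_ge0.
    have -> : (N ^+ 2 * kappa)%:E = (\sum_(i < n) \sum_(j < n) kappa%:E)%E.
      under [RHS]eq_bigr do rewrite sumEFin; rewrite sumEFin; congr (_%:E).
      by rewrite !sumr_const !card_ord -mulrnA -[RHS]mulr_natl natrM /N; ring.
    apply: lee_sum => i _.
    under eq_integral do rewrite -sumEFin.
    rewrite ge0_integral_sum//; last 2 first.
    - by move=> j; apply/measurable_EFinP; exact: mz.
    - by move=> j w _; rewrite lee_fin sqr_ge0.
    by apply: lee_sum => j _.
  move=> h1; apply: le_trans (lee_wpmul2l _ h1) _; first by rewrite lee_fin ltW.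
  rewrite -EFinM lee_fin /h le_eqVlt; apply/orP; left; apply/eqP.
  by field; rewrite !gt_eqF.
have bg : bounded_mfun (fun w => \sum_j \sum_l (\sum_i x i j w * x i l w) ^+ 2).
  do 2 (apply: bounded_mfun_sum => ? _); under eq_fun do rewrite expr2.
  by apply: bounded_mfunM; apply: bounded_mfun_sum => i _; exact: bounded_mfunM.
have be : bounded_mfun (fun w => \sum_i expR (- row i w)).
  by apply: bounded_mfun_sum => i _; exact: bounded_exp_row.
have bY2 : bounded_mfun Y2 by apply: bounded_mfunD; exact: bounded_mfunZ.
have Y2_le : (\int[P]_w Y2 w <= 32 * B ^+ 4 / (eta ^+ 2 * n%:R) +
       n%:R * expR (c * n%:R) * q ^+ n.-1)%R.
  rewrite /Y2 (meanD P (bounded_mfunZ _ bg) (bounded_mfunZ _ be)).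
  rewrite (meanZ P _ bg) (meanZ P _ be); apply: lerD.
    apply: le_trans (ler_wpM2l (sqr_ge0 h) mean_gram) _.
    rewrite le_eqVlt; apply/orP; left; apply/eqP.
    by rewrite /h /N; field; rewrite !gt_eqF.
  rewrite mean_sum; last by move=> i _; exact: bounded_exp_row.
  rewrite (eq_bigr (fun=> q ^+ n.-1)); last by move=> i _; exact: mean_exp_row.
  rewrite sumr_const card_ord -[_ ^+ _ *+ n]mulr_natl le_eqVlt; apply/orP; left.
  by apply/eqP; rewrite /N; ring.
have [mA PA] := markov_lt1 mY1 Y10 Y1_le bY2 Y20.
exists [set w | Y1 w + Y2 w < 1]; split => //.
  apply: le_trans PA; rewrite lee_fin; move: Y2_le.
  by move: (\int[P]_w Y2 w)%R => Y; lra.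
move=> w /= Yw u.
apply: (@interaction_matrix_bound _ _ _ (fun i j => x i j w) (fun i j => z i j w) m).
- exact: ltW.
- exact: c0.
- move=> i j; rewrite strength_matrixE /x /z; case: eqP => _ //.
  by rewrite subrK /clip_tail addrC subrK.
- by move=> i; rewrite /x eqxx.
- by move=> i; rewrite /z eqxx.
- exact: m_le_eta.
- have Y1w : Y1 w <= 1 by rewrite ltW// (le_lt_trans _ Yw)// lerDl.
  by move: Y1w; rewrite /Y1 /h mulrC ler_pdivrMr ?mul1r// mulr_gt0// exprn_gt0.
- have : h ^+ 2 * (\sum_j \sum_l (\sum_i x i j w * x i l w) ^+ 2) <= 1.
    rewrite ltW// (le_lt_trans _ Yw)// /Y2 addrCA lerDl addr_ge0//.
    by rewrite mulr_ge0 ?expR_ge0.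
  rewrite /h exprVn mulrC ler_pdivrMr ?mul1r// exprn_gt0// mulr_gt0//.
  exact: exprn_gt0.
- move=> i.
  have -> : \sum_k `|strength_matrix (fun i j => sel i j w) (fun i j => str i j w) i k| = row i w.
    rewrite /row [RHS]big_mkcond/=; apply: eq_bigr => k _.
    by rewrite strength_matrixE; case: eqP => _ //=; rewrite normr0.
  (* A single summand of the Chernoff term is at most [Y2 w <= 1], so its exponent [c * N - row i w]
     is nonpositive. *)
  rewrite -/N -subr_ge0 -oppr_le0 opprB -ler_expR expR0 expRD.
  apply: (@le_trans _ _ (Y2 w)); last first.
    by rewrite ltW// (le_lt_trans _ Yw)// lerDr.
  apply: (@le_trans _ _ (expR (c * N) * \sum_i expR (- row i w))).
    rewrite ler_wpM2l ?expR_ge0// (bigD1 i)//= lerDl.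
    by apply: sumr_ge0 => k _; exact: expR_ge0.
  by rewrite /Y2 lerDr mulr_ge0 ?sqr_ge0.
Qed.

End truncation.
End coupling_event.

(** * Conclusion *)

(** With [y] the square root of [x], [(n + 1) y^n] is at most the geometric sum, hence at most
    [1 / (1 - y)]; the other factor [y^n] tends to [0]. *)
Lemma cvg_natM_expr (R : realType) (x : R) : 0 <= x -> x < 1 ->
  (fun n => n.+1%:R * x ^+ n) @ \oo --> (0 : R).
Proof.
move=> x0 x1; pose y := Num.sqrt x.
have y0 : 0 <= y by exact: sqrtr_ge0.
have y1 : y < 1 by rewrite -sqrtr1 ltr_sqrt.
have cy : (fun n => (1 - y)^-1 * y ^+ n) @ \oo --> (0 : R).
  by apply: cvg_geometric; rewrite ger0_norm.
apply: squeeze_cvgr (cvg_cst 0) cy; apply: nearW => n; apply/andP; split.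
  by rewrite mulr_ge0// exprn_ge0.
rewrite -[x]sqr_sqrtr// -/y -exprM mulnC exprM expr2 mulrA ler_wpM2r ?exprn_ge0//.
rewrite -[leRHS]mul1r ler_pdivlMr ?subr_gt0//.
have : (1 - y) * \sum_(i < n.+1) y ^+ i <= 1.
  by rewrite -opprB mulNr -subrX1 opprB gerBl exprn_ge0.
apply: le_trans; rewrite mulrC ler_wpM2l ?subr_ge0 ?(ltW y1)//.
rewrite (_ : n.+1%:R * y ^+ n = \sum_(i < n.+1) y ^+ n); last first.
  by rewrite sumr_const card_ord mulr_natl.
by apply: ler_sum => i _; rewrite ler_wiXn2l ?(ltW y1)// -ltnS.
Qed.

(** * Inner probabilities tending to one *)

Section inner_probability.
Context (d : measure_display) (T : measurableType d) (R : realType)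
  (P : probability T R).

Lemma inner_prob_le1 (E : set T) : (inner_prob P E <= 1)%E.
Proof. by apply: ge_ereal_sup => _ [A [mA _] <-]; exact: probability_le1. Qed.

Lemma inner_prob_ge (A E : set T) : measurable A -> A `<=` E ->
  (P A <= inner_prob P E)%E.
Proof. by move=> mA AE; apply: ereal_sup_ubound; exists A. Qed.

Lemma inner_prob_setT : inner_prob P [set: T] = 1%E.
Proof. by rewrite inner_probE// probability_setT. Qed.

End inner_probability.

Lemma cvg_inner_prob1 (R : realType) (d : nat -> measure_display)
    (T : forall n, measurableType (d n)) (P : forall n, probability (T n) R)
    (E : forall n, set (T n)) :
  (forall e : R, 0 < e ->
    \forall n \near \oo, ((1 - e)%:E <= inner_prob (P n) (E n))%E) ->
  inner_prob (P n) (E n) @[n --> \oo] --> 1%E.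
Proof.
move=> h; apply/fine_cvgP.
have fin n : inner_prob (P n) (E n) \is a fin_num.
  rewrite fin_numE; apply/andP; split.
    rewrite -ltNye; apply: lt_le_trans (inner_prob_ge (P n) measurable0 (@sub0set _ _)).
    by rewrite measure0.
  by rewrite -ltey (le_lt_trans (inner_prob_le1 _ _))// ltry.
split; first exact: nearW.
apply/cvgrPdist_le => e e0; apply: filterS (h e e0) => n.
have := inner_prob_le1 (P n) (E n); rewrite -(fineK (fin n)) !lee_fin /= => h1 h2.
by rewrite ger0_norm; lra.
Qed.

Lemma tau_l_le_pihalf (R : realType) (p sigma absZ : R) (n : nat) :
  0 < p -> 0 < sigma -> 0 <= absZ -> (0 < n)%N -> tau_l p sigma absZ n <= pi / 2.
Proof.
move=> p0 s0 a0 n0; rewrite /tau_l /alpha.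
set a := _ * absZ; set v := Num.sqrt _.
have a_ge0 : 0 <= a by rewrite !mulr_ge0 ?(ltW p0)// subr_ge0 ler1n.
have v0 : 0 < v by rewrite sqrtr_gt0 !mulr_gt0 ?ltr0n// exprn_gt0.
rewrite ler_pdivrMr; last by lra.
by have := mulr_ge0 (pi_ge0 R) (ltW v0); nra.
Qed.

(** Fixes the parameters of [coupling_event] independently of [n], so that each of its three error
    terms is eventually at most [delta / 3]. *)
Lemma small_coupling_whp (R : realType)
    (dZ : measure_display) (TZ : measurableType dZ) (PZ : probability TZ R)
    (Z : {RV PZ >-> R}) (sigma p : R)
    (Z_mean : ('E_PZ[Z] = 0)%E)
    (sigma_gt0 : 0 < sigma) (Z_var : 'V_PZ[Z] = (sigma ^+ 2)%:E)
    (p_gt0 : 0 < p) (p_le1 : p <= 1)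
    (d : nat -> measure_display) (T : forall n : nat, measurableType (d n))
    (P : forall n : nat, probability (T n) R)
    (sel : forall n : nat, 'I_n -> 'I_n -> {RV (P n) >-> bool})
    (str : forall n : nat, 'I_n -> 'I_n -> {RV (P n) >-> R})
    (model : forall n : nat, random_mixed_interactions Z p (sel n) (str n))
    (e delta : R) : 0 < e -> 0 < delta ->
  \forall n \near \oo, exists A : set (T n), [/\ measurable A,
    ((1 - delta)%:E <= P n A)%E &
    forall w, A w -> forall u : 'I_n -> R,
      \sum_i (\sum_j random_interaction_matrix (sel n) (str n) w i j * u j) ^+ 2 <=
      e ^+ 2 * \sum_j u j ^+ 2].
Proof.
move=> e0 delta0.
pose q := (1 - p) + p * (\int[PZ]_w expR (- `|Z w|))%R.
have q0 : 0 <= q.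
  rewrite addr_ge0 ?subr_ge0// mulr_ge0 ?(ltW p_gt0)//.
  by apply: Rintegral_ge0 => w _; exact: expR_ge0.
have q1 : q < 1.
  have := mean_expN_lt1 Z_mean Z_var sigma_gt0; rewrite -subr_gt0.
  by move=> /(mulr_gt0 p_gt0); rewrite /q; move: (\int[PZ]_w _)%R => x; lra.
(* Then [exp c <= 1 / (1 - c)] gives [exp c * q <= 2 q / (1 + q) < 1]. *)
pose c := (1 - q) / 2.
have c0 : 0 < c by rewrite /c; lra.
pose rho := expR c * q.
have rho0 : 0 <= rho by rewrite mulr_ge0// expR_ge0.
have rho1 : rho < 1.
  have c1 : 0 < 1 - c by rewrite /c; lra.
  have h : expR c <= (1 - c)^-1.
    rewrite -[c in expR c]opprK expRN lef_pV2 ?posrE ?expR_gt0//.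
    exact: expR_ge1Dx.
  rewrite /rho (le_lt_trans (ler_wpM2r q0 h))// mulrC ltr_pdivrMr// mul1r /c.
  by lra.
(* Solves [9 eta / c^2 = e^2]. *)
pose eta := e ^+ 2 * c ^+ 2 / 9.
have eta0 : 0 < eta by rewrite divr_gt0// mulr_gt0// exprn_gt0.
(* The bounds by [1] and [eta] give [kappa^2 <= eta], needed for the squared mean; the last one
   makes the tail error at most [delta / 3]. *)
pose kappa := Num.min (Num.min 1 eta) (eta * delta / 3).
have kappa0 : 0 < kappa by rewrite !lt_min ltr01 eta0 divr_gt0// mulr_gt0.
have kappa1 : kappa <= 1 by rewrite !ge_min lexx.
have kappa_eta : kappa <= eta by rewrite !ge_min lexx orbT.
have kappa_delta : kappa / eta <= delta / 3.
  by rewrite ler_pdivrMr// mulrAC [_ * eta]mulrC ge_min lexx orbT.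
have [B B1 hB] := tail_second_moment Z_mean Z_var kappa0.
have B0 : 0 <= B by rewrite (le_trans ler01).
have m_eta : (p * (\int[PZ]_w clip B (Z w))%R) ^+ 2 <= eta.
  have h1 := mean_clip_le Z_mean Z_var B1 hB.
  have h2 : `|p * (\int[PZ]_w clip B (Z w))%R| <= kappa.
    by rewrite normrM (ger0_norm (ltW p_gt0)) -[leRHS]mul1r ler_pM// ltW.
  rewrite -real_normK ?num_real//; apply: le_trans kappa_eta.
  have := normr_ge0 (p * (\int[PZ]_w clip B (Z w))%R); nra.
have tail_le : (\int[PZ]_w (clip_tail B (Z w) ^+ 2)%:E <= kappa%:E)%E.
  rewrite -lee_fin in hB; apply: le_trans hB; rewrite /Rintegral fineK//.
  exact: integrable_fin_num (integrable_sqr_tail Z_mean Z_var B).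
have d3 : 0 < delta / 3 by rewrite divr_gt0.
have near1 : \forall n \near \oo, 32 * B ^+ 4 / (eta ^+ 2 * n%:R) <= delta / 3.
  pose k := 32 * B ^+ 4 / eta ^+ 2 / (delta / 3).
  exists (Num.truncn k).+1 => // n /= kn.
  have n0 : 0 < (n%:R : R) by rewrite ltr0n (leq_trans _ kn).
  rewrite invfM mulrA ler_pdivrMr// [_ * n%:R]mulrC -ler_pdivrMr// -/k.
  by rewrite (le_trans (ltW (truncnS_gt _)))// ler_nat.
have near2 : \forall n \near \oo, n%:R * expR (c * n%:R) * q ^+ n.-1 <= delta / 3.
  (* For [n = k + 1] the error term is [exp c * ((k + 1) rho^k)], hence the division by [expR c]
     below. *)
  have := cvg_natM_expr rho0 rho1.
  move=> /cvgrPdist_le/(_ _ (divr_gt0 d3 (expR_gt0 c)))[N _ hN].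
  exists N.+1 => // -[//|n] /= Nn; have := hN n Nn.
  rewrite sub0r normrN ger0_norm; last by rewrite mulr_ge0// exprn_ge0.
  rewrite ler_pdivlMr ?expR_gt0// /rho exprMn -expRM_natl => h.
  apply: le_trans h; rewrite le_eqVlt; apply/orP; left; apply/eqP.
  by rewrite -natr1 mulrDr mulr1 expRD [c * _]mulrC; ring.
near=> n.
have n0 : (0 < n)%N by near: n; exists 1%N.
have [A [mA PA hA]] := coupling_event (model n) p_le1 (ltW p_gt0) B0 n0 eta0 c0 tail_le m_eta.
exists A; split => //.
  apply: le_trans PA; rewrite lee_fin lerD2l lerN2.
  have h1 : 32 * B ^+ 4 / (eta ^+ 2 * n%:R) <= delta / 3 by near: n.
  have h2 : n%:R * expR (c * n%:R) * q ^+ n.-1 <= delta / 3 by near: n.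
  by rewrite -/q; lra.
move=> w Aw u; have := hA w Aw u.
by rewrite (_ : 9 * eta / c ^+ 2 = e ^+ 2)// /eta; field; rewrite gt_eqF.
Unshelve. all: by end_near.
Qed.

Theorem theorem4 (R : realType)
    (dZ : measure_display) (TZ : measurableType dZ) (PZ : probability TZ R)
    (Z : {RV PZ >-> R}) (sigma p : R)
    (Z_mean : ('E_PZ[Z] = 0)%E)
    (sigma_gt0 : 0 < sigma) (Z_var : 'V_PZ[Z] = (sigma ^+ 2)%:E)
    (p_gt0 : 0 < p) (p_le1 : p <= 1)
    (d : nat -> measure_display) (T : forall n : nat, measurableType (d n))
    (P : forall n : nat, probability (T n) R)
    (sel : forall n : nat, 'I_n -> 'I_n -> {RV (P n) >-> bool})
    (str : forall n : nat, 'I_n -> 'I_n -> {RV (P n) >-> R})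
    (model : forall n : nat, random_mixed_interactions Z p (sel n) (str n))
    (tau : R) (tau_ge0 : 0 <= tau) :
  inner_prob (P n) [set w : T n |
      tau < tau_star p sigma (fine 'E_PZ[fun x => `|Z x|%R]%E) n ->
      delayed_system_converges
        (1%:M - random_interaction_matrix (sel n) (str n) w) tau]
    @[n --> \oo] --> 1%E.
Proof.
set absZ := fine _.
have absZ0 : 0 <= absZ.
  by apply: fine_ge0; apply: expectation_ge0 => w; exact: normr_ge0.
apply: cvg_inner_prob1 => delta delta0.
have [tau_lt|tau_ge] := ltP tau (pi / 2); last first.
  (* When [tau >= pi / 2] the premise fails for every [n >= 1], and the event is the whole space. *)
  exists 1%N => // n /= n0.
  rewrite (_ : [set w | _] = setT).
    by rewrite inner_prob_setT lee_fin; lra.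
  apply/seteqP; split => // w _ /=.
  have := tau_l_le_pihalf p_gt0 sigma_gt0 absZ0 n0.
  rewrite /tau_star lt_min => h /andP[_ h'].
  by have := lt_le_trans h' (le_trans h tau_ge); rewrite ltxx.
have [e e0 he] := small_coupling_converges tau_ge0 tau_lt.
have := small_coupling_whp Z_mean sigma_gt0 Z_var p_gt0 p_le1 model e0 delta0.
apply: filterS => n [A [mA PA hA]].
apply: le_trans PA _; apply: inner_prob_ge => // w Aw _ /=.
exact/he/hA.
Qed.
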